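(* Fix an integer $\Delta\ge3$, a real $\lambda\ge1$ and $\kappa\in(1,\Delta/2]$. Let $$\beta=\tfrac12\,e^{-\left(1+\frac{2}{\kappa-1}\right)}\left(\frac{\Delta}{2\kappa}\right)^{-\left(1+\frac{1}{\kappa-1}\right)},$$ and let $q\ge2$ be an integer satisfying $q-1\le\frac{\beta^2}{256e^2}\lambda^{\Delta-\kappa-\frac{\kappa^2}{\Delta-\kappa}}$. Let $G$ be uniformly random in $\mathcal{G}_{n,\Delta}$. Then asymptotically almost surely the Glauber dynamics $\mathcal{M}=\mathcal{M}_{\mathrm{GD}}(G,\lambda,q)$ satisfies $\tau(\mathcal{M})\ge2^{\beta n-4}$.
   Context: Potts model on $G=(V,E)$: configurations $\sigma\in[q]^V$, $\mu(\sigma)$ = number of monochromatic edges, Gibbs distribution $\pi(\sigma)\propto\lambda^{\mu(\sigma)}$. Glauber dynamics $\mathcal{M}_{\mathrm{GD}}(G,\lambda,q)$: from $X_t$ choose a uniformly random vertex $v$, choose $c\in[q]$ with probability proportional to $\lambda^{n(X_t,v,c)}$ ($n(X,v,c)$ = number of neighbours of $v$ coloured $c$ in $X$), and recolour $v$ with $c$. $\tau(\mathcal{M})=\max_x\min\{t:\|P^t(x,\cdot)-\pi\|_{TV}\le 1/(2e)\}$. $\mathcal{G}_{n,\Delta}$ is the uniform probability space of $\Delta$-regular simple graphs on $\{1,\dots,n\}$ ($n$ even if $\Delta$ odd); asymptotically almost surely means with probability tending to $1$ as $n\to\infty$. *)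

(* Defs.v *)
From mathcomp Require Import all_boot.
From Stdlib Require Import Reals ClassicalEpsilon.

Set Implicit Arguments.
Unset Strict Implicit.
Unset Printing Implicit Defensive.

Definition sumR (T : finType) (P : pred T) (F : T -> R) : R :=
  \big[Rplus/0%R]_(x : T | P x) F x.

Definition graph (n : nat) := {ffun 'I_n * 'I_n -> bool}.

Definition is_simple_regular (n D : nat) (A : graph n) : bool :=
  [forall u : 'I_n, ~~ A (u, u)] &&
  [forall u : 'I_n, forall v : 'I_n, A (u, v) == A (v, u)] &&
  [forall u : 'I_n, #|[set v : 'I_n | A (u, v)]| == D].

Definition config (n q : nat) := {ffun 'I_n -> 'I_q}.

Section Potts.
Variables (n q : nat) (A : graph n) (lam : R).

Definition mono_edges (x : config n q) : nat :=
  #|[set e : 'I_n * 'I_n | [&& (e.1 < e.2)%N, A e & x e.1 == x e.2]]|.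

Definition nbr_col (x : config n q) (v : 'I_n) (c : 'I_q) : nat :=
  #|[set w : 'I_n | A (v, w) && (x w == c)]|.

Definition gibbs (x : config n q) : R :=
  (lam ^ mono_edges x / sumR predT (fun y : config n q => lam ^ mono_edges y))%R.

Definition glauber (x y : config n q) : R :=
  (/ INR n * sumR predT (fun v : 'I_n =>
     if [forall w : 'I_n, (w != v) ==> (x w == y w)]
     then lam ^ nbr_col x v (y v) /
          sumR predT (fun c : 'I_q => lam ^ nbr_col x v c)
     else 0))%R.

Fixpoint glauber_pow (t : nat) (x y : config n q) : R :=
  match t with
  | 0 => if x == y then 1%R else 0%R
  | t'.+1 => sumR predT (fun z => (glauber_pow t' x z * glauber z y)%R)
  end.

Definition tv_dist (t : nat) (x : config n q) : R :=
  (/ 2 * sumR predT (fun y => Rabs (glauber_pow t x y - gibbs y)))%R.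

(* tau(M) >= T, where tau(M) = max_x min{t : ||P^t(x,.) - pi||_TV <= 1/(2e)}
   (with min of the empty set = +infinity):  some starting state x such that
   every t with distance <= 1/(2e) satisfies t >= T. *)
Definition mixing_time_ge (T : R) : Prop :=
  exists x : config n q,
    forall t : nat, (tv_dist t x <= / (2 * exp 1))%R -> (T <= INR t)%R.

End Potts.

Definition indicator (P : Prop) : R :=
  if excluded_middle_informative P then 1%R else 0%R.

Definition prob_regular (n D : nat) (P : graph n -> Prop) : R :=
  (sumR (fun A : graph n => is_simple_regular D A) (fun A => indicator (P A))
   / INR #|[pred A : graph n | is_simple_regular D A]|)%R.

Definition aas (D : nat) (P : forall n, graph n -> Prop) : Prop :=
  forall eps : R, (0 < eps)%R ->
    exists N : nat, forall n : nat, (N <= n)%N -> (odd D -> ~~ odd n) ->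
      (1 - eps <= @prob_regular n D (P n))%R.

Definition beta_const (D : nat) (kappa : R) : R :=
  (/ 2 * exp (- (1 + 2 / (kappa - 1)))
       * Rpower (INR D / (2 * kappa)) (- (1 + 1 / (kappa - 1))))%R.

(* Main.v *)
(** Let [e(S)] be the number of edges inside [S], [k] the least integer above [beta n / 2],
and suppose that [e(S) <= kappa k] for all [S] with [#|S| = k].  For a colour [c0],
let [A] be the configurations with at most [k] vertices coloured differently from
[c0], and [B] those with exactly [k].  The chain leaves [A] only through [B], and
[pi A <= 1/2] by symmetry between colours, so the mixing time is of order at least
[pi A / pi B].  To bound [pi B], recolour the vertices of [S] one at a time: with
[Q = q - 1], a vertex with [b] neighbours already recoloured contributes a factor
at most [lam^b + Q - 1 <= 2 Q h^b], where [h = lam Q^(-1/D)], besides the loss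
[lam^(b - D)].  Hence the configurations that differ from [c0] exactly on [S] weigh at
most [(2 Q / lam^D)^k (h lam)^(e(S))] times the constant configuration, and the
hypothesis on [q] turns the sum over all [S] into [4^(-k) <= 2^(-beta n)].

That random regular graphs have the sparsity property follows from a switching:
replacing an edge [uv] inside [S] and an edge [xy] outside [S] by [ux] and [vy] shows
that graphs with [e(S) >= j + 1] are fewer than those with [e(S) >= j] by a factor
[(D k)^2 / (2 (j + 1) (D n - 2 D k - 2 D^2))], and a union bound over [S] concludes. *)

Require Import Defs.
From Stdlib Require Import Reals Lra Lia ClassicalEpsilon ZArith.
From HB Require Import structures.
From mathcomp Require Import all_boot perm zify_ssreflect.
Delimit Scope R_scope with R.

Set Implicit Arguments.
Unset Strict Implicit.
Unset Printing Implicit Defensive.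

(** * The edges of a regular graph *)

(** Each edge at [v] is listed once by its other end, and [f] puts that pair in increasing order.
    With [B] the monochromatic adjacency, this isolates how [mono_edges] depends on the colour at
    [v]. *)
Lemma card_edges_at (n : nat) (B : rel 'I_n) (v : 'I_n) :
  (forall a, ~~ B a a) -> (forall a b, B a b = B b a) ->
  #|[set e : 'I_n * 'I_n | (e.1 < e.2)%N && B e.1 e.2]| =
  (#|[set e : 'I_n * 'I_n | [&& (e.1 < e.2)%N, B e.1 e.2, e.1 != v & e.2 != v]]|
   + #|[set w | B v w]|)%N.
Proof.
move=> Birr Bsym.
set N := [set w | B v w]; set E' := [set e | [&& _, _, _ & _]].
pose f (w : 'I_n) := if (w < v)%N then (w, v) else (v, w).
have finj : injective f.
  move=> a b; rewrite /f; case: ifP => av; case: ifP => bv [] //.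
  - by move=> ->.
  - by move=> -> ->.
have -> : [set e : 'I_n * 'I_n | (e.1 < e.2)%N && B e.1 e.2] = E' :|: f @: N.
  apply/setP=> -[a b]; rewrite !inE /=; apply/idP/idP.
    case/andP=> ab Bab; rewrite ab Bab /=.
    have [ea|na] := eqVneq a v; have [eb|nb] := eqVneq b v; rewrite ?orbT //=.
    - by move: ab; rewrite ea eb ltnn.
    - apply/imsetP; exists b; first by rewrite inE -ea.
      by rewrite /f ifN ?ea // -leqNgt -ea ltnW.
    - apply/imsetP; exists a; first by rewrite inE Bsym -eb.
      by rewrite /f -eb ab.
  case/orP=> [/and4P[-> -> //]|/imsetP[w]].
  rewrite inE => Bvw; rewrite /f; case: ifP => wv [-> ->].
    by rewrite wv Bsym.
  rewrite Bvw andbT ltn_neqAle leqNgt wv andbT.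
  by apply/eqP => /val_inj e; move: Bvw; rewrite e (negPf (Birr _)).
rewrite cardsU card_imset // [X in (_ - X)%N](_ : _ = 0%N) ?subn0 //.
apply/eqP; rewrite cards_eq0 -subset0; apply/subsetP => e.
rewrite !inE => /andP[/and4P[_ _ n1 n2] /imsetP[w _ ew]].
by move: n1 n2; rewrite ew /f; case: ifP; rewrite eqxx.
Qed.

Definition regular (n D : nat) (A : graph n) :=
  [/\ forall u, ~~ A (u, u), forall u v, A (u, v) = A (v, u)
    & forall u, #|[set v | A (u, v)]| = D].

Lemma regularP (n D : nat) (A : graph n) :
  reflect (regular D A) (is_simple_regular D A).
Proof.
apply: (iffP andP) => [[/andP[/forallP irr /forallP sym] /forallP deg]|[irr sym deg]].
  split=> // [u v|u]; last exact/eqP.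
  by have /forallP/(_ v)/eqP := sym u.
split; last by apply/forallP=> u; rewrite deg.
apply/andP; split; apply/forallP=> u //.
by apply/forallP=> v; rewrite sym.
Qed.

(* Twice the number of edges inside [S]. *)
Definition inner_deg (n : nat) (A : graph n) (S : {set 'I_n}) : nat :=
  \sum_(u in S) #|[set w in S | A (u, w)]|.

Section InnerDegree.
Variables (n D : nat) (A : graph n).
Hypothesis Areg : regular D A.

Lemma inner_degD1 (S : {set 'I_n}) (v : 'I_n) : v \in S ->
  inner_deg A S = (inner_deg A (S :\ v) + (#|[set w in S :\ v | A (v, w)]|).*2)%N.
Proof.
case: Areg => irr sym _ vS.
rewrite /inner_deg (big_setD1 v) //=.
have E u : #|[set w in S | A (u, w)]| =
           (A (u, v) + #|[set w in S :\ v | A (u, w)]|)%N.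
  rewrite (cardsD1 v) inE vS /=; congr (_ + _)%N.
  by apply: eq_card => w; rewrite !inE andbA.
rewrite (eq_bigr _ (fun u _ => E u)) big_split /= E (negPf (irr v)) add0n.
have -> : \sum_(u in S :\ v) A (u, v) = #|[set w in S :\ v | A (v, w)]|.
  rewrite -sum1_card big_mkcond [RHS]big_mkcond /=; apply: eq_bigr => u _.
  by rewrite !inE sym; case: ifP => // _; case: (A _).
by rewrite addnA addnn addnC.
Qed.

Lemma inner_deg0 : inner_deg A set0 = 0%N.
Proof. by rewrite /inner_deg big_set0. Qed.

Lemma inner_degE (S : {set 'I_n}) :
  inner_deg A S =
  #|[set e : 'I_n * 'I_n | [&& e.1 \in S, e.2 \in S & A e]]|.
Proof.
rewrite /inner_deg -sum1_card (eq_bigr _ (fun u _ => esym (sum1_card _))).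
rewrite pair_big_dep /=; apply: eq_bigl => -[u w] /=.
by rewrite !inE /=.
Qed.

End InnerDegree.

(** * Switchings *)

(* Replaces the edges [uv], [xy] by [ux], [vy].  Permuting rows by transpositions makes
   the preservation of degrees and the involutivity immediate. *)
Definition switch (n : nat) (A : graph n) (u v x y : 'I_n) : graph n :=
  [ffun p => if (p.1 == u) || (p.1 == y) then A (p.1, tperm v x p.2)
             else if (p.1 == v) || (p.1 == x) then A (p.1, tperm u y p.2)
             else A p].

Lemma switchK (n : nat) (A : graph n) (u v x y : 'I_n) :
  switch (switch A u v x y) u v x y = A.
Proof.
apply/ffunP=> -[w z]; rewrite !ffunE /=.
by case: ((w == u) || (w == y)); [|case: ((w == v) || (w == x))]; rewrite ?tpermK.
Qed.

Definition switchable (n : nat) (A : graph n) (S : {set 'I_n})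
    (u v x y : 'I_n) : bool :=
  [&& u \in S, v \in S, x \notin S & y \notin S] &&
  [&& A (u, v), A (x, y), ~~ A (u, x) & ~~ A (v, y)].

Section Switching.
Variables (n D : nat) (S : {set 'I_n}).
Implicit Type A : graph n.

Lemma switch_regular A u v x y : regular D A -> switchable A S u v x y ->
  regular D (switch A u v x y).
Proof.
move=> [irr sym deg] /andP[/and4P[uS vS xS yS] /and4P[Auv Axy Aux Avy]].
have neq a b : a \in S -> b \notin S -> a != b by move=> aS; apply: contraNneq => <-.
have nux := neq _ _ uS xS; have nuy := neq _ _ uS yS.
have nvx := neq _ _ vS xS; have nvy := neq _ _ vS yS.
have nuv : u != v by apply: contraTneq Auv => ->; exact: irr.
have nxy : x != y by apply: contraTneq Axy => ->; exact: irr.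
have Avu := Auv; rewrite sym in Avu; have Ayx := Axy; rewrite sym in Ayx.
have Axu := Aux; rewrite sym in Axu; have Ayv := Avy; rewrite sym in Ayv.
have cardp (s : {perm 'I_n}) w : #|[set z | A (w, s z)]| = D.
  rewrite -[RHS](deg w) -[RHS](card_preimset _ (@perm_inj _ s)).
  by apply: eq_card => z; by rewrite !inE.
split.
- move=> w; rewrite ffunE /=; have [->|nwu] := eqVneq w u.
    by rewrite /= tpermD // eq_sym.
  have [->|nwy] := eqVneq w y; first by rewrite /= tpermD // eq_sym.
  have [->|nwv] := eqVneq w v; first by rewrite /= tpermD // eq_sym.
  have [->|nwx] := eqVneq w x; first by rewrite /= tpermD // eq_sym.
  exact: irr.
- move=> w z; rewrite !ffunE /=.
  have facts := (negPf nux, negPf nuy, negPf nvx, negPf nvy, negPf nuv, negPf nxy,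
    negPf Aux, negPf Avy, negPf Axu, negPf Ayv, Auv, Avu, Axy, Ayx, eqxx).
  have facts' := (eq_sym v u, eq_sym x u, eq_sym y u, eq_sym x v, eq_sym y v, eq_sym y x).
  (* Every modified entry has both indices among [u], [v], [x], [y], so symmetry reduces to a finite
     check on these four vertices. *)
  have cases4 c : [\/ c = u, c = v, c = x | c = y]
      \/ [/\ (c == u) = false, (c == v) = false, (c == x) = false & (c == y) = false].
    case: (eqVneq c u) => [->|_]; first by left; constructor 1.
    case: (eqVneq c v) => [->|_]; first by left; constructor 2.
    case: (eqVneq c x) => [->|_]; first by left; constructor 3.
    case: (eqVneq c y) => [->|_]; first by left; constructor 4.
    by right.
  rewrite !permE /=.
  by case: (cases4 w) => [[]->|[w1 w2 w3 w4]];
     case: (cases4 z) => [[]->|[z1 z2 z3 z4]];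
     rewrite ?facts ?facts' ?facts ?w1 ?w2 ?w3 ?w4 ?z1 ?z2 ?z3 ?z4 /= ?facts // sym.
- move=> w; rewrite -[RHS](deg w); have [e|ne] := boolP ((w == u) || (w == y)).
    rewrite deg -(cardp (tperm v x) w); apply: eq_card => z.
    by rewrite !inE ffunE /= e.
  have [e|ne'] := boolP ((w == v) || (w == x)).
    rewrite deg -(cardp (tperm u y) w); apply: eq_card => z.
    by rewrite !inE ffunE /= (negPf ne) e.
  by apply: eq_card => z; rewrite !inE ffunE /= (negPf ne) (negPf ne').
Qed.

(** As [x] and [y] lie outside [S], the only ordered pairs inside [S] that can disappear are
    [(u, v)] and [(v, u)]. *)
Lemma switch_inner_deg A u v x y : switchable A S u v x y ->
  (inner_deg A S <= (inner_deg (switch A u v x y) S).+2)%N.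
Proof.
move=> /andP[/and4P[uS vS xS yS] /and4P[Auv Axy Aux Avy]].
rewrite !inner_degE.
set X := [set e | _]; set Y := [set e | _].
have sub : X \subset (u, v) |: ((v, u) |: Y).
  apply/subsetP=> -[a b]; rewrite !inE ffunE /= !xpair_eqE => /and3P[aS bS Aab].
  rewrite aS bS /=.
  have neq c : c \in S -> (c == x) = false /\ (c == y) = false.
    by move=> cS; split; apply/negbTE; [move: xS | move: yS]; apply: contraNneq => <-.
  have [ax ay] := neq _ aS; have [bx b_y] := neq _ bS.
  rewrite ax ay !orbF.
  case: (eqVneq a u) Aab => [->|nau] Aab.
    have [->|nbv] := eqVneq b v; first by [].
    by rewrite tpermD ?Aab ?orbT // eq_sym ?bx.
  case: (eqVneq a v) Aab => [->|nav] Aab; last by rewrite Aab !orbT.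
  have [->|nbu] := eqVneq b u; first by rewrite orbT.
  by rewrite tpermD ?Aab ?orbT // eq_sym ?b_y.
apply: leq_trans (subset_leq_card sub) _.
rewrite !cardsU1; case: (_ \notin _); case: (_ \notin _); lia.
Qed.

End Switching.

(** * Double counting of switchings *)

Definition dense_graphs (n D : nat) (S : {set 'I_n}) (j : nat) : {set graph n} :=
  [set A | is_simple_regular D A && (j.*2 <= inner_deg A S)%N].

Section SwitchCount.
Variables (n D : nat) (S : {set 'I_n}).
Implicit Type A : graph n.

Lemma card_arcs_from A (X : {set 'I_n}) : regular D A ->
  #|[set e : 'I_n * 'I_n | (e.1 \in X) && A e]| = (#|X| * D)%N.
Proof.
case=> _ _ deg; rewrite -sum_nat_const -(eq_bigr _ (fun u _ => deg u)).
rewrite -sum1_card (eq_bigr _ (fun u _ => esym (sum1_card _))).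
rewrite pair_big_dep /=; apply: eq_bigl => -[u w] /=.
by rewrite !inE /=.
Qed.

Lemma card_arcs_to A (X : {set 'I_n}) : regular D A ->
  #|[set e : 'I_n * 'I_n | (e.2 \in X) && A e]| = (#|X| * D)%N.
Proof.
move=> Areg; rewrite -(card_arcs_from X Areg).
have swapK : involutive (fun e : 'I_n * 'I_n => (e.2, e.1)) by case.
rewrite -[RHS](card_imset _ (inv_inj swapK)).
case: Areg => _ sym _; apply: eq_card => -[a b]; rewrite (can_imset_pre _ swapK).
by rewrite !inE /= sym.
Qed.

(** Among the [D * n] arcs [(x, y)], the unusable ones have an end in [S], at most [2 * D * #|S|],
    or have [x] adjacent to [u] or [y] adjacent to [v], at most [D * D] each. *)
Lemma card_switch_targets A u v : regular D A -> u \in S -> v \in S -> A (u, v) ->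
  (D * n <= #|[set p | switchable A S u v p.1 p.2]| + 2 * D * #|S| + 2 * D * D)%N.
Proof.
move=> Areg uS vS Auv; case: (Areg) => _ _ deg.
set G := [set p | _].
have sub : [set e : 'I_n * 'I_n | (e.1 \in [set: 'I_n]) && A e] \subset
   G :|: (([set e | (e.1 \in S) && A e] :|: [set e | (e.2 \in S) && A e]) :|:
   ([set e | (e.1 \in [set w | A (u, w)]) && A e]
    :|: [set e | (e.2 \in [set w | A (v, w)]) && A e])).
  apply/subsetP=> -[x y]; rewrite !inE /= => Axy.
  rewrite /switchable uS vS Auv Axy /= !andbT.
  by case: (x \in S); case: (y \in S); case: (A (u, x)); case: (A (v, y)).
have := subset_leq_card sub; rewrite card_arcs_from // cardsT card_ord mulnC.
move=> /leq_trans; apply.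
apply: leq_trans (leq_card_setU _ _) _.
rewrite -!addnA leq_add2l.
apply: leq_trans (leq_card_setU _ _) _.
apply: leq_add; apply: leq_trans (leq_card_setU _ _) _;
  rewrite card_arcs_from // card_arcs_to // ?deg; lia.
Qed.

Lemma dense_graphs_step (j : nat) :
  (#|dense_graphs D S j.+1| * ((j.+1).*2 * (D * n - 2 * D * #|S| - 2 * D * D))
   <= #|dense_graphs D S j| * (#|S| * D) ^ 2)%N.
Proof.
set M := (_ - 2 * D * D)%N.
pose W := [set s : graph n * (('I_n * 'I_n) * ('I_n * 'I_n)) |
  (s.1 \in dense_graphs D S j.+1) && switchable s.1 S s.2.1.1 s.2.1.2 s.2.2.1 s.2.2.2].
pose W' := [set s : graph n * (('I_n * 'I_n) * ('I_n * 'I_n)) |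
  (s.1 \in dense_graphs D S j)
  && (s.2 \in setX [set e | (e.1 \in S) && s.1 e] [set e | (e.1 \in S) && s.1 e])].
(* The arcs kept by [f] are the new edges [(u, x)] and [(v, y)], which start in [S]: hence the bound
   [(#|S| * D) ^ 2] on reverse switchings. They still determine all four vertices, so [switchK]
   recovers the graph. *)
pose f (s : graph n * (('I_n * 'I_n) * ('I_n * 'I_n))) :=
  (switch s.1 s.2.1.1 s.2.1.2 s.2.2.1 s.2.2.2,
   ((s.2.1.1, s.2.2.1), (s.2.1.2, s.2.2.2))).
have finj : injective f.
  move=> [A [[u v] [x y]]] [A' [[u' v'] [x' y']]] [/= eA eu ex ev ey].
  by subst; rewrite -(switchK A u' v' x' y') eA switchK.
have W'card : #|W'| = (#|dense_graphs D S j| * (#|S| * D) ^ 2)%N.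
  rewrite -sum_nat_const -sum1_card.
  transitivity (\sum_(A in dense_graphs D S j)
     \sum_(p in setX [set e | (e.1 \in S) && A e] [set e | (e.1 \in S) && A e]) 1)%N.
    by rewrite pair_big_dep /=; apply: eq_bigl => s; rewrite inE.
  apply: eq_bigr => A; rewrite inE => /andP[/regularP Areg _].
  by rewrite sum1_card cardsX card_arcs_from // mulnn.
have Wcard : (#|dense_graphs D S j.+1| * ((j.+1).*2 * M) <= #|W|)%N.
  rewrite -sum_nat_const -sum1_card.
  have -> : (\sum_(s in W) 1 = \sum_(A in dense_graphs D S j.+1)
     \sum_(p : ('I_n * 'I_n) * ('I_n * 'I_n)
           | switchable A S p.1.1 p.1.2 p.2.1 p.2.2) 1)%N.
    by rewrite pair_big_dep /=; apply: eq_bigl => s; rewrite inE.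
  apply: leq_sum => A; rewrite inE => /andP[/regularP Areg le].
  apply: leq_trans (leq_mul le (leqnn M)) _.
  rewrite inner_degE -sum_nat_const.
  have -> : (\sum_(p : ('I_n * 'I_n) * ('I_n * 'I_n)
           | switchable A S p.1.1 p.1.2 p.2.1 p.2.2) 1 =
     \sum_(e in [set e : 'I_n * 'I_n | [&& e.1 \in S, e.2 \in S & A e]])
       \sum_(p : 'I_n * 'I_n | switchable A S e.1 e.2 p.1 p.2) 1)%N.
    rewrite pair_big_dep /=; apply: eq_bigl => -[[u v] [x y]] /=.
    rewrite inE /= /switchable.
    by case: (u \in S); case: (v \in S); case: (A (u, v)); rewrite //= andbF.
  apply: leq_sum => -[u v]; rewrite inE /= => /and3P[uS vS Auv].
  have := card_switch_targets Areg uS vS Auv.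
  rewrite sum1dep_card /M -subnDA leq_subLR; set g := #|_|; set g1 := #|_|; lia.
apply: leq_trans Wcard _; rewrite -W'card -(card_imset _ finj).
apply/subset_leq_card/subsetP=> _ /imsetP[[A [[u v] [x y]]] + ->].
rewrite !inE /= => /andP[/andP[/regularP Areg le] sw].
have /regularP -> := switch_regular Areg sw.
have := switch_inner_deg sw.
move: (sw) => /andP[/and4P[uS vS xS yS] /and4P[Auv Axy Aux Avy]].
rewrite uS vS /= !ffunE /= !eqxx /= tpermR Auv => le2.
have -> : (j.*2 <= inner_deg (switch A u v x y) S)%N by lia.
rewrite /=.
have nvu : v != u by apply: contraTneq Auv => ->; case: Areg => irr _ _; exact: irr.
have nvy : v != y by apply: contraNneq yS => <-.
rewrite (negPf nvu) (negPf nvy) /= tpermR.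
by case: Areg => _ sym _; rewrite sym.
Qed.

End SwitchCount.

(** * Existence of regular graphs *)

Lemma sum_ord_between (n a b : nat) :
  (\sum_(i < n) ((a <= i) && (i < b)) = minn n b - a)%N.
Proof.
elim: n => [|n IH]; first by rewrite big_ord0; lia.
by rewrite big_ord_recr /= IH; lia.
Qed.

(* Circulant graph: [u] and [v] are joined when their cyclic distance is at most
   [D / 2], and also when it is [n / 2] if [D] is odd.  Existence matters because
   [prob_regular] is the junk value [0 / 0 = 0] on an empty space. *)
Lemma regular_graph_exists (n D : nat) : (D < n)%N -> (odd D -> ~~ odd n) ->
  exists A : graph n, is_simple_regular D A.
Proof.
move=> Dn par; have n0 : (0 < n)%N by lia.
pose h := D./2.
pose P (d : nat) := [|| (0 < d) && (d < h.+1), (n - h <= d) && (d < n)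
                      | odd D && (d.*2 == n)]%N.
pose dist (u v : 'I_n) := (if v < u then v + n - u else v - u)%N.
have dist_lt u v : (dist u v < n)%N.
  by rewrite /dist; case: ifP => ?; have := ltn_ord u; have := ltn_ord v; lia.
(* For fixed [u] the cyclic distance is an injective self-map of ['I_n], so every degree equals the
   number of [d] satisfying [P]. *)
pose f u v := Ordinal (dist_lt u v).
have finj u : injective (f u).
  move=> v w /(congr1 val) /=; rewrite /dist => e; apply: val_inj.
  move: e (ltn_ord u) (ltn_ord v) (ltn_ord w) => /=.
  by case: ifP => ?; case: ifP => ?; lia.
exists [ffun p => P (dist p.1 p.2)]; apply/regularP; split.
- move=> u; rewrite ffunE /= /dist ltnn subnn /P; lia.
- move=> u v; rewrite !ffunE /= /P /dist.
  have := ltn_ord u; have := ltn_ord v.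
  by case: ifP => ?; case: ifP => ?; lia.
- move=> u; transitivity #|[set d : 'I_n | P d]|.
    rewrite -[RHS](card_preimset _ (finj u)).
    by apply: eq_card => v; rewrite !inE ffunE.
  rewrite -sum1_card big_mkcond /=.
  (* The three conditions in [P] exclude each other because [D < n], so the indicator is a sum. The
     last interval is the single point [n./2] for odd [D]; for even [D] it starts at [n] and is
     empty. *)
  transitivity (\sum_(i < n) (((0 < i) && (i < h.+1)) + ((n - h <= i) && (i < n))
     + ((odd D * n./2 + (~~ odd D) * n <= i) && (i < (n./2).+1))))%N.
    apply: eq_bigr => i _; rewrite inE /P -[LHS]/(nat_of_bool _) /h.
    have := ltn_ord i; have := odd_double_half D; have := odd_double_half n.
    case: (odd D) par; case: (odd n) => //= par e1 e2 lt; try (by have := par isT);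
    rewrite /= ?mul0n ?mul1n; case: (boolP (0 < i < _)%N) => c1; case: (boolP (_ <= i < n)%N) => c2; case: (boolP (_ <= i < (n./2).+1)%N) => c3; rewrite /=; lia.
  rewrite !big_split /= !sum_ord_between /h.
  by have := odd_double_half D; case: (odd D) => /=; rewrite ?mul0n ?mul1n; lia.
Qed.

(** * Finite sums of reals and Markov chains *)

Local Open Scope R_scope.

Lemma Rplus_assoc_law : associative Rplus.
Proof. by move=> x y z; ring. Qed.

HB.instance Definition _ :=
  Monoid.isComLaw.Build R 0%R Rplus Rplus_assoc_law Rplus_comm Rplus_0_l.
HB.instance Definition _ := Monoid.isMulLaw.Build R 0%R Rmult Rmult_0_l Rmult_0_r.
HB.instance Definition _ :=
  Monoid.isAddLaw.Build R Rmult Rplus (fun x y z => Rmult_plus_distr_r x y z)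
    (fun x y z => Rmult_plus_distr_l x y z).

Section SumR.
Variable T : finType.
Implicit Types (P : pred T) (F G : T -> R).

Lemma sumR_ge0 P F : (forall x, P x -> 0 <= F x) -> 0 <= sumR P F.
Proof.
move=> F0; rewrite /sumR; apply: (big_ind (fun r => 0 <= r)) => //; first lra.
by move=> a b; lra.
Qed.

Lemma sumR_le P F G : (forall x, P x -> F x <= G x) -> sumR P F <= sumR P G.
Proof.
move=> le; rewrite /sumR; apply: (big_ind2 (fun a b => a <= b)) => //; first lra.
by move=> a b c d; lra.
Qed.

Lemma sumRD P F G : sumR P (fun x => F x + G x) = sumR P F + sumR P G.
Proof. exact: big_split. Qed.

Lemma sumR_mull P F c : sumR P (fun x => c * F x) = c * sumR P F.
Proof. by rewrite /sumR big_distrr. Qed.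

Lemma sumR_mulr P F c : sumR P (fun x => F x * c) = sumR P F * c.
Proof. by rewrite /sumR big_distrl. Qed.

Lemma sumRC P F (Q : pred T) : sumR P F = sumR (predI P Q) F + sumR (predD P Q) F.
Proof.
rewrite /sumR (bigID Q) /=; congr (_ + _).
by apply: eq_bigl => x /=; rewrite andbC.
Qed.

Lemma sumR_sub P (Q : pred T) F : (forall x, Q x -> P x) ->
  (forall x, P x -> 0 <= F x) -> sumR Q F <= sumR P F.
Proof.
move=> QP F0; rewrite (sumRC P F Q).
have -> : sumR (predI P Q) F = sumR Q F.
  by apply: eq_bigl => x /=; case Qx: (Q x); rewrite ?andbF ?andbT ?QP.
have := @sumR_ge0 (predD P Q) F; rewrite /predD /= => H.
by have := H (fun x Px => F0 x (proj2 (andP Px))); lra.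
Qed.

Lemma sumR_const P c : sumR P (fun _ => c) = INR #|P| * c.
Proof.
rewrite /sumR big_const; elim: #|P| => [|m IH]; first by rewrite /=; ring.
by rewrite iterS IH S_INR; ring.
Qed.

Lemma le_sumR P F x : P x -> (forall y, P y -> 0 <= F y) -> F x <= sumR P F.
Proof.
move=> Px F0; rewrite /sumR (bigD1 x) //=.
have := @sumR_ge0 (fun y => P y && (y != x)) F; rewrite /sumR => H.
by have := H (fun y Py => F0 y (proj1 (andP Py))); lra.
Qed.

Lemma eq_sumR P F G : (forall x, P x -> F x = G x) -> sumR P F = sumR P G.
Proof. exact: eq_bigr. Qed.

Lemma eq_sumRl P (Q : pred T) F : P =1 Q -> sumR P F = sumR Q F.
Proof. exact: eq_bigl. Qed.

Lemma sumR_exchange (I : finType) P (Q : pred I) (F : T -> I -> R) :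
  sumR P (fun x => sumR Q (F x)) = sumR Q (fun i => sumR P (F^~ i)).
Proof. exact: exchange_big. Qed.

End SumR.

(** * Escape of a stationary chain from a set through its boundary *)

Section MarkovChain.
Variables (T : finType) (K : T -> T -> R) (w : T -> R).

Fixpoint kernel_pow (t : nat) (x y : T) : R :=
  match t with
  | 0 => if x == y then 1 else 0
  | t'.+1 => sumR predT (fun z => kernel_pow t' x z * K z y)
  end.

Hypothesis K_ge0 : forall x y, 0 <= K x y.
Hypothesis K_sum1 : forall x, sumR predT (K x) = 1.
Hypothesis w_ge0 : forall x, 0 <= w x.
Hypothesis w_stat : forall y, sumR predT (fun x => w x * K x y) = w y.

Lemma kernel_pow_ge0 t x y : 0 <= kernel_pow t x y.
Proof.
elim: t y => [|t IH] y /=; first by case: ifP => _; lra.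
by apply: sumR_ge0 => z _; apply: Rmult_le_pos.
Qed.

Lemma kernel_pow_sum1 t x : sumR predT (kernel_pow t x) = 1.
Proof.
elim: t => [|t IH] /=.
  by rewrite /sumR -big_mkcond (big_pred1 x) // => y; rewrite eq_sym.
rewrite sumR_exchange -IH; apply: eq_sumR => z _.
by rewrite sumR_mull K_sum1; ring.
Qed.

Lemma kernel_pow_stationary t y : sumR predT (fun x => w x * kernel_pow t x y) = w y.
Proof.
elim: t y => [|t IH] y /=.
  rewrite /sumR (bigD1 y) //= eqxx big1 => [|x /negPf ->]; ring.
rewrite -[RHS]w_stat.
under eq_sumR => x _ do rewrite -sumR_mull.
rewrite sumR_exchange; apply: eq_sumR => z _.
by rewrite -IH -sumR_mulr; apply: eq_sumR => x _; ring.
Qed.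

Variables A B : pred T.
Hypothesis exit_through_B : forall x y, A x -> ~~ B x -> ~~ A y -> K x y = 0.

(** Mass that leaves [A] at some step sat in [B] just before, so each step adds to the outside at
    most the current mass of [B]. *)
Lemma kernel_pow_exit x t : A x ->
  sumR (predC A) (kernel_pow t x)
  <= sumR predT (fun s : 'I_t => sumR B (kernel_pow s x)).
Proof.
move=> Ax; elim: t => [|t IH].
  rewrite /sumR big_ord0 big1 /=; first lra.
  by move=> y /negP nA; case: eqP => // e; case: nA; rewrite -e.
rewrite {2}/sumR big_ord_recr /=; apply: Rle_trans (Rplus_le_compat_r _ _ _ IH).
rewrite sumR_exchange.
have mk (P : pred T) : sumR P (kernel_pow t x)
    = sumR predT (fun z => if P z then kernel_pow t x z else 0).
  by rewrite /sumR big_mkcond.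
rewrite -/(sumR B _) !mk -sumRD; apply: sumR_le => z _.
rewrite sumR_mull /=; have p0 := kernel_pow_ge0 t x z.
have le1 : sumR (predC A) (K z) <= 1.
  by rewrite -(K_sum1 z); apply: sumR_sub.
have ge0 : 0 <= sumR (predC A) (K z) by apply: sumR_ge0.
case Bz: (B z); case Az: (A z) => /=; try nra.
rewrite [sumR _ _](_ : _ = 0); first lra.
by rewrite /sumR big1 // => y nAy; apply: exit_through_B; rewrite ?Bz.
Qed.

(* The number of visits to [B] before time [t] has mean at most [t * w B / w A] when
   the chain starts from [w] conditioned on [A]; some starting state does at least as
   well as this average, and a chain that has left [A] has visited [B]. *)
Lemma slow_start t : 0 < sumR A w ->
  exists2 x, A x & forall s, (s <= t)%N ->
    sumR (predC A) (kernel_pow s x) <= INR t * (sumR B w / sumR A w).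
Proof.
move=> wA.
pose V x := sumR predT (fun s : 'I_t => sumR B (kernel_pow s x)).
have avg : sumR A (fun x => w x * V x) <= INR t * sumR B w.
  have -> : INR t * sumR B w = sumR predT (fun x => w x * V x).
    rewrite /V; under [RHS]eq_sumR => x _ do rewrite -sumR_mull.
    rewrite sumR_exchange -{1}(card_ord t) -sumR_const.
    apply: eq_sumR => s _.
    under [RHS]eq_sumR => x _ do rewrite -sumR_mull.
    rewrite sumR_exchange; apply: eq_sumR => y _.
    by rewrite kernel_pow_stationary.
  apply: sumR_sub => // x _; apply: Rmult_le_pos => //.
  by do 2 (apply: sumR_ge0 => ? _); apply: kernel_pow_ge0.
have [[x [Ax Vx]]|no] := classic (exists x, A x /\ V x <= INR t * (sumR B w / sumR A w)).
  exists x => // s st; apply: Rle_trans (kernel_pow_exit s Ax) (Rle_trans _ _ _ _ Vx).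
  rewrite /V /sumR -!(big_mkord predT (fun i => sumR B (kernel_pow i x))) /=.
  rewrite (big_cat_nat (leq0n s) st) /=.
  rewrite -[X in X <= _]Rplus_0_r; apply: Rplus_le_compat_l.
  apply: (big_ind (fun r => 0 <= r)); [lra | by move=> *; lra |].
  by move=> i _; apply: sumR_ge0 => y _; apply: kernel_pow_ge0.
suff : sumR A (fun x => w x * (INR t * (sumR B w / sumR A w))) < sumR A (fun x => w x * V x).
  rewrite sumR_mulr => lt; exfalso.
  have e : sumR A w * (INR t * (sumR B w / sumR A w)) = INR t * sumR B w by field; lra.
  lra.
(* [w] may vanish at some states; strict inequality of the two sums needs one state of [A] with
   positive weight. *)
have [x0 Ax0 wx0] : exists2 x, A x & 0 < w x.
  apply: NNPP => H; suff : sumR A w <= 0 by lra.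
  have -> : sumR A w = sumR A (fun _ => 0).
    apply: eq_sumR => x Ax; apply: NNPP => ne; apply: H; exists x => //.
    by have := w_ge0 x; lra.
  by rewrite sumR_const; lra.
have lt x : A x -> INR t * (sumR B w / sumR A w) < V x.
  by move=> Ax; apply: Rnot_le_lt => le; apply: no; exists x.
rewrite /sumR (bigD1 x0) //= [X in _ < X](bigD1 x0) //=.
apply: Rplus_lt_le_compat; first by apply: Rmult_lt_compat_l => //; apply: lt.
apply: sumR_le => x /andP[Ax _]; apply: Rmult_le_compat_l => //.
by apply: Rlt_le; apply: lt.
Qed.

End MarkovChain.

(** Both total masses being one, the excess of [f] on [A] equals that of [g] on the complement.
    Together they are at most the full sum of absolute differences, whence the factor one half. *)
Lemma event_le_tv (T : finType) (A : pred T) (f g : T -> R) :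
  sumR predT f = 1 -> sumR predT g = 1 ->
  sumR A f - sumR A g <= / 2 * sumR predT (fun y => Rabs (f y - g y)).
Proof.
rewrite !(sumRC predT _ A) => f1 g1.
have E h : sumR (predI predT A) h = sumR A h by [].
rewrite !E in f1 g1 *.
have le (P : pred T) (a b : T -> R) :
    sumR P a <= sumR P (fun y => Rabs (a y - b y)) + sumR P b.
  by rewrite -sumRD; apply: sumR_le => y _; have := Rle_abs (a y - b y); lra.
have := le A f g; have := le (predD predT A) g f.
under [X in _ <= X + _]eq_sumR => y _ do rewrite Rabs_minus_sym.
lra.
Qed.

(** * Glauber dynamics *)

Definition recolor (n q : nat) (x : config n q) (v : 'I_n) (c : 'I_q) : config n q :=
  [ffun w => if w == v then c else x w].

Section Glauber.
Variables (n D q : nat) (A : graph n) (lam : R).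
Hypothesis Areg : regular D A.
Hypothesis lam_ge1 : 1 <= lam.
Implicit Types x y : config n q.

Definition agree_off (v : 'I_n) x y := [forall w, (w != v) ==> (x w == y w)].

Lemma agree_offP v x y :
  reflect (forall w, w != v -> x w = y w) (agree_off v x y).
Proof.
apply: (iffP forallP) => H w; last by apply/implyP => /H ->.
by move/(implyP (H w))/eqP.
Qed.

Lemma agree_off_sym v x y : agree_off v x y = agree_off v y x.
Proof. by apply/agree_offP/agree_offP => H w /H. Qed.

Lemma lam_pow_gt0 m : 0 < lam ^ m.
Proof. by apply: pow_lt; lra. Qed.

Lemma nbr_col_agree_off v x y c : agree_off v x y ->
  nbr_col A x v c = nbr_col A y v c.
Proof.
move=> /agree_offP xy; apply: eq_card => w; rewrite !inE.
case Avw: (A (v, w)) => //=; rewrite xy //.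
by apply: contraTneq Avw => ->; case: Areg.
Qed.

(** Edges away from [v] have the same status in both configurations. The form without subtraction is
    the equality of exponents needed in [glauber_reversible]. *)
Lemma mono_edges_agree_off v x y : agree_off v x y ->
  (mono_edges A x + nbr_col A y v (y v) = mono_edges A y + nbr_col A x v (x v))%N.
Proof.
case: Areg => irr sym _ /agree_offP xy.
have E z : mono_edges A z =
    (#|[set e : 'I_n * 'I_n | [&& (e.1 < e.2)%N, A e && (z e.1 == z e.2),
         e.1 != v & e.2 != v]]| + nbr_col A z v (z v))%N.
  pose B a b := A (a, b) && (z a == z b).
  transitivity #|[set e : 'I_n * 'I_n | (e.1 < e.2)%N && B e.1 e.2]|.
    by apply: eq_card => -[a b]; rewrite !inE.
  rewrite (card_edges_at v) /B => [|a|a b]; last by rewrite sym eq_sym.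
    congr (_ + _)%N; apply: eq_card => e; rewrite !inE; first by case: e.
    by rewrite [z v == _]eq_sym.
  by rewrite (negPf (irr a)).
rewrite !E addnAC; congr (_ + _ + _)%N; apply: eq_card => e; rewrite !inE.
case n1: (e.1 != v); case n2: (e.2 != v); rewrite ?andbF // !xy //.
Qed.

Lemma sum_agree_off v x (F : 'I_q -> R) :
  sumR predT (fun y : config n q => if agree_off v x y then F (y v) else 0)
  = sumR predT F.
Proof.
rewrite /sumR -big_mkcond (reindex_onto (recolor x v) (fun y : config n q => y v)) /=.
  apply: eq_big => [c|c _]; rewrite ffunE eqxx ?eqxx // andbT.
  by apply/agree_offP => w /negPf nw; rewrite ffunE nw.
move=> y /agree_offP xy; apply/ffunP => w; rewrite ffunE.
by case: eqP => [->|/eqP /xy ->].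
Qed.

Lemma glauberE x y : glauber A lam x y =
  / INR n * sumR predT (fun v => if agree_off v x y then
     lam ^ nbr_col A x v (y v) / sumR predT (fun c : 'I_q => lam ^ nbr_col A x v c)
   else 0).
Proof. by []. Qed.

Hypothesis n_gt0 : (0 < n)%N.

Lemma INR_gt0 m : (0 < m)%N -> 0 < INR m.
Proof. by move=> /ltP /lt_INR. Qed.

Lemma site_weight_gt0 x v : 0 < sumR predT (fun c : 'I_q => lam ^ nbr_col A x v c).
Proof.
apply: (Rlt_le_trans _ _ _ (lam_pow_gt0 (nbr_col A x v (x v)))).
apply: (@le_sumR _ predT (fun c => lam ^ nbr_col A x v c)) => // c _.
exact/Rlt_le/lam_pow_gt0.
Qed.

Lemma glauber_ge0 x y : 0 <= glauber A lam x y.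
Proof.
apply: Rmult_le_pos; first exact/Rlt_le/Rinv_0_lt_compat/INR_gt0.
apply: sumR_ge0 => v _; case: ifP => _; last lra.
apply: Rmult_le_pos; first exact/Rlt_le/lam_pow_gt0.
exact/Rlt_le/Rinv_0_lt_compat/site_weight_gt0.
Qed.

Lemma glauber_sum1 x : sumR predT (glauber A lam x) = 1.
Proof.
have H y := glauberE x y.
rewrite (eq_sumR (fun y _ => H y)) sumR_mull sumR_exchange.
rewrite (eq_sumR (G := fun _ => 1)) => [|v _].
  by rewrite sumR_const card_ord; field; apply/Rgt_not_eq/INR_gt0.
rewrite (@sum_agree_off v x (fun c => lam ^ nbr_col A x v c / _)).
by rewrite sumR_mulr; apply: Rinv_r; apply/Rgt_not_eq/site_weight_gt0.
Qed.

(** Detailed balance holds separately for each chosen vertex [v]: the normalising sum ignores the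
    colour at [v], and [mono_edges_agree_off] matches the powers of [lam]. *)
Lemma glauber_reversible x y :
  lam ^ mono_edges A x * glauber A lam x y = lam ^ mono_edges A y * glauber A lam y x.
Proof.
rewrite !glauberE -!Rmult_assoc ![_ * / INR n]Rmult_comm !Rmult_assoc; congr (_ * _).
rewrite -!sumR_mull; apply: eq_sumR => v _.
rewrite (agree_off_sym v y x); case: ifP => xy; last by rewrite !Rmult_0_r.
have e c := nbr_col_agree_off c xy.
have -> : sumR predT (fun c : 'I_q => lam ^ nbr_col A x v c)
  = sumR predT (fun c : 'I_q => lam ^ nbr_col A y v c).
  by apply: eq_sumR => c _; rewrite e.
rewrite /Rdiv -!Rmult_assoc; congr (_ * _).
by rewrite -!pow_add e -(e (x v)); congr (_ ^ _); apply: mono_edges_agree_off.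
Qed.

Definition partition_fun := sumR predT (fun y : config n q => lam ^ mono_edges A y).

Lemma gibbs_ge0 x : 0 <= gibbs A lam x.
Proof.
apply: Rmult_le_pos; first exact/Rlt_le/lam_pow_gt0.
apply/Rlt_le/Rinv_0_lt_compat.
apply: (Rlt_le_trans _ _ _ (lam_pow_gt0 (mono_edges A x))).
apply: (@le_sumR _ predT (fun x => lam ^ mono_edges A x)) => // y _.
exact/Rlt_le/lam_pow_gt0.
Qed.

Lemma gibbs_stationary y : sumR predT (fun x => gibbs A lam x * glauber A lam x y)
  = gibbs A lam y.
Proof.
rewrite -[RHS]Rmult_1_r -(glauber_sum1 y) -sumR_mull; apply: eq_sumR => x _.
have := glauber_reversible x y; rewrite /gibbs /Rdiv => e.
by rewrite Rmult_assoc [/ _ * _]Rmult_comm -Rmult_assoc e; ring.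
Qed.

Lemma gibbs_sum (P : pred (config n q)) :
  sumR P (gibbs A lam) = sumR P (fun x => lam ^ mono_edges A x) / partition_fun.
Proof. by rewrite /gibbs /Rdiv sumR_mulr. Qed.

Lemma glauber_powE t x y : glauber_pow A lam t x y = kernel_pow (glauber A lam) t x y.
Proof. by elim: t y => //= t IH y; apply: eq_sumR => z _; rewrite IH. Qed.

Definition others (c0 : 'I_q) x := [set v | x v != c0].

Definition colour_weight (P : pred (config n q)) :=
  sumR P (fun x => lam ^ mono_edges A x).

(** A single update changes at most one vertex, so the number of vertices not coloured [c0] cannot
    jump over [k]. *)
Lemma glauber_exit c0 k x y : (#|others c0 x| <= k)%N -> #|others c0 x| != k ->
  ~~ (#|others c0 y| <= k)%N -> glauber A lam x y = 0.
Proof.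
move=> lek nek gtk; rewrite glauberE [sumR _ _](_ : _ = 0); first ring.
rewrite /sumR big1 // => v _; case: ifP => // /agree_offP xy; case/negP: gtk.
have sub : others c0 y \subset v |: others c0 x.
  apply/subsetP => w; rewrite !inE => yw.
  by have [//|nw] := eqVneq w v; rewrite xy.
apply: leq_trans (subset_leq_card sub) _; rewrite cardsU1.
by case: (v \notin _); lia.
Qed.

(** Exchanging two colours is an involution of the configurations that preserves monochromatic
    edges. *)
Lemma colour_weight_swap c0 c1 k :
  colour_weight (fun x => (#|others c0 x| <= k)%N)
  = colour_weight (fun x => (#|others c1 x| <= k)%N).
Proof.
pose f (x : config n q) : config n q := [ffun v => tperm c0 c1 (x v)].
have fK : involutive f by move=> x; apply/ffunP => v; rewrite !ffunE tpermK.
rewrite /colour_weight /sumR (reindex_inj (inv_inj fK)) /=.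
apply: eq_big => [x|x _].
  congr (_ <= _)%N; apply: eq_card => v; rewrite !inE ffunE.
  by rewrite -{2}(tpermR c0 c1) (inj_eq perm_inj).
congr (_ ^ _); apply: eq_card => e; rewrite !inE !ffunE.
by rewrite (inj_eq perm_inj).
Qed.

(** For [s < T], the start given by [slow_start] keeps mass at least 7/8 in [In], whose Gibbs mass
    is at most 1/2. The distance is then at least 3/8, which exceeds 1/4 and so 1/(2e). *)
Lemma mixing_time_geI c0 c1 k (T : R) : c0 != c1 -> (2 * k < n)%N -> 0 <= T ->
  (T + 1) * colour_weight (fun x => #|others c0 x| == k)
    <= / 8 * colour_weight (fun x => (#|others c0 x| <= k)%N) ->
  mixing_time_ge q A lam T.
Proof.
move=> c01 kn T0 small.
pose In := fun x => (#|others c0 x| <= k)%N.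
pose Bd := fun x => #|others c0 x| == k.
have Z_gt0 : 0 < partition_fun.
  apply: (Rlt_le_trans _ _ _ (lam_pow_gt0 (mono_edges A ([ffun=> c0] : config n q)))).
  apply: (@le_sumR _ predT (fun x => lam ^ mono_edges A x)) => // y _.
  exact/Rlt_le/lam_pow_gt0.
have In_gt0 : 0 < colour_weight In.
  apply: (Rlt_le_trans _ _ _ (lam_pow_gt0 (mono_edges A ([ffun=> c0] : config n q)))).
  apply: (@le_sumR _ In (fun x => lam ^ mono_edges A x)) => [|y _].
    rewrite /In [others _ _](_ : _ = set0) ?cards0 //.
    by apply/setP => v; rewrite !inE ffunE eqxx.
  exact/Rlt_le/lam_pow_gt0.
have In_half : sumR In (gibbs A lam) <= / 2.
  rewrite gibbs_sum -/(colour_weight In).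
  apply: (Rmult_le_reg_r partition_fun) => //.
  rewrite /Rdiv Rmult_assoc Rinv_l ?Rmult_1_r; last lra.
  (* The sets around [c0] and [c1] are disjoint: every vertex differs from one of the two colours,
     and [2 * k < n]. Having equal weight, each has at most half of the total. *)
  suff : colour_weight In + colour_weight (fun x => (#|others c1 x| <= k)%N)
      <= partition_fun by rewrite -(colour_weight_swap c0 c1 k) -/In; lra.
  rewrite /partition_fun (sumRC _ _ In); apply: Rplus_le_compat.
    by rewrite /colour_weight; apply: Req_le; apply: eq_sumRl.
  apply: sumR_sub => [x lec1|x _] /=; last exact/Rlt_le/lam_pow_gt0.
  rewrite andbT; apply/negP => lec0.
  have : (#|[set: 'I_n]| <= #|others c0 x| + #|others c1 x|)%N.
    apply: leq_trans (leq_card_setU _ _); apply: subset_leq_card.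
    apply/subsetP => v _; rewrite !inE; case: eqP => // ->.
    by rewrite c01.
  by rewrite cardsT card_ord; move: lec0 lec1; rewrite /In; lia.
(* Rounding [T] up to an integer horizon costs at most one, which is the [T + 1] of the
   hypothesis. *)
have [t [tT Tt]] : exists t, INR t <= T + 1 /\ forall s, INR s < T -> (s <= t)%N.
  have [up1 up2] := archimed T; exists (Z.to_nat (up T)).
  have up0 : (0 <= up T)%Z by apply: le_IZR; lra.
  have e : INR (Z.to_nat (up T)) = IZR (up T) by rewrite INR_IZR_INZ Z2Nat.id.
  split=> [|s sT]; first by rewrite e; lra.
  by apply/leP; apply: INR_le; rewrite e; lra.
have gIn_gt0 : 0 < sumR In (gibbs A lam).
  by rewrite gibbs_sum; apply: Rdiv_lt_0_compat.
have [x xIn stay] := slow_start glauber_ge0 glauber_sum1 gibbs_ge0 gibbs_stationary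
  (fun x y a b => glauber_exit (x := x) (y := y) a b) t gIn_gt0.
exists x => s tv; apply: Rnot_lt_le => sT.
have := stay s (Tt s sT).
have r : INR t * (sumR Bd (gibbs A lam) / sumR In (gibbs A lam)) <= / 8.
  rewrite !gibbs_sum -/(colour_weight In) -/(colour_weight Bd).
  have -> : INR t * (colour_weight Bd / partition_fun / (colour_weight In / partition_fun))
     = INR t * colour_weight Bd / colour_weight In by field; lra.
  apply: (Rmult_le_reg_r (colour_weight In)) => //.
  rewrite /Rdiv Rmult_assoc Rinv_l ?Rmult_1_r; last lra.
  apply: Rle_trans small; apply: Rmult_le_compat_r => //.
  by apply: sumR_ge0 => y _; apply/Rlt_le/lam_pow_gt0.
move=> /Rle_trans /(_ r) out0.
have out : sumR (predC In) (kernel_pow (glauber A lam) s x) <= / 8 by [].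
have p1 := kernel_pow_sum1 glauber_sum1 s x.
have g1 : sumR predT (gibbs A lam : config n q -> R) = 1.
  by rewrite gibbs_sum; apply: (Rinv_r partition_fun); lra.
have := event_le_tv In p1 g1.
have -> : / 2 * sumR predT (fun y => Rabs (kernel_pow (glauber A lam) s x y - gibbs A lam y))
   = tv_dist A lam s x.
  by rewrite /tv_dist; congr (_ * _); apply: eq_sumR => y _; rewrite glauber_powE.
rewrite (sumRC _ _ In) in p1.
have e1 : sumR (predD predT In) (kernel_pow (glauber A lam) s x)
    = sumR (predC In) (kernel_pow (glauber A lam) s x).
  by apply: eq_sumRl => y; rewrite /= andbT.
have e2 : sumR (predI predT In) (kernel_pow (glauber A lam) s x)
    = sumR In (kernel_pow (glauber A lam) s x) by [].
have e3 : / (2 * exp 1) <= / 4.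
  by apply: Rinv_le_contravar; have := exp_ineq1_le 1; lra.
rewrite e1 e2 in p1.
move: p1 out In_half tv e3; lra.
Qed.

End Glauber.

(** * Weight of the configurations with a given support *)

(* [lam^m - 1] is superadditive in [m]. *)
Lemma sum_pow_le (I : finType) (P : pred I) (lam : R) (m : I -> nat) (b : nat) :
  1 <= lam -> (\sum_(i | P i) m i <= b)%N ->
  sumR P (fun i => lam ^ m i) <= lam ^ b + INR #|P| - 1.
Proof.
move=> lam1 mb.
have le : sumR P (fun i => lam ^ m i + -1) <= lam ^ (\sum_(i | P i) m i) - 1.
  rewrite /sumR; apply: (big_ind2 (fun r d => r <= lam ^ d - 1)) => [|r1 d1 r2 d2|i _].
  - by rewrite /=; lra.
  - rewrite pow_add; have := pow_R1_Rle lam d1 lam1; have := pow_R1_Rle lam d2 lam1; nra.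
  - lra.
rewrite sumRD sumR_const in le.
have := Rle_pow lam _ _ lam1 (elimT leP mb); lra.
Qed.

Section SupportWeight.
Variables (n D q : nat) (A : graph n) (lam : R) (c0 : 'I_q).
Hypothesis Areg : regular D A.
Hypothesis lam_ge1 : 1 <= lam.

Definition support_weight (S : {set 'I_n}) :=
  colour_weight A lam (fun x => others c0 x == S).

Lemma support_weight_ge0 S : 0 <= support_weight S.
Proof. by apply: sumR_ge0 => x _; apply/Rlt_le/lam_pow_gt0. Qed.

Lemma others_recolor (x : config n q) v c :
  others c0 (recolor x v c) = if c == c0 then others c0 x :\ v else v |: others c0 x.
Proof.
apply/setP => w; rewrite !inE ffunE; case: (c =P c0) => [->|/eqP nc]; rewrite !inE;
  by case: (w == v); rewrite ?eqxx.
Qed.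

Lemma recolor_id (x : config n q) v : recolor x v (x v) = x.
Proof. by apply/ffunP => w; rewrite ffunE; case: eqP => [->|]. Qed.

Lemma recolor_recolor (x : config n q) v c c' :
  recolor (recolor x v c) v c' = recolor x v c'.
Proof. by apply/ffunP => w; rewrite !ffunE; case: eqP. Qed.

(** Resetting [v] to [c0] groups the configurations by their image [x]; the fibre over [x] consists
    of its recolourings at [v] by the other colours. *)
Lemma support_weightD1 (S : {set 'I_n}) (v : 'I_n) : v \in S ->
  support_weight S =
  sumR (fun x => others c0 x == S :\ v) (fun x : config n q =>
    sumR (fun c => c != c0) (fun c => lam ^ mono_edges A (recolor x v c))).
Proof.
move=> vS; rewrite /support_weight /colour_weight /sumR.
rewrite (partition_big (fun x : config n q => recolor x v c0)
  (fun x => others c0 x == S :\ v)) => [|x /eqP xS] /=; last first.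
  by rewrite others_recolor eqxx xS.
apply: eq_bigr => x /eqP xS.
have xv : x v = c0.
  by apply/eqP; have := setD11 v S; rewrite -xS inE => /negbFE.
rewrite (reindex_onto (recolor x v) (fun y : config n q => y v)) /=; last first.
  move=> y /andP[_ /eqP yx]; apply/ffunP => w; rewrite ffunE; case: eqP => [->//|/eqP nw].
  by rewrite -yx ffunE (negPf nw).
apply: eq_bigl => c.
have r0 : recolor x v c0 = x by rewrite -xv recolor_id.
rewrite recolor_recolor others_recolor r0 eqxx andbT ffunE eqxx eqxx andbT.
case: (c =P c0) => [_|_] /=; last by rewrite xS setD1K ?eqxx.
by apply/negP => /eqP/setP/(_ v); rewrite !inE eqxx vS.
Qed.

Lemma card_nbrs_in_le (S : {set 'I_n}) v : (#|[set w in S | A (v, w)]| <= D)%N.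
Proof.
case: Areg => _ _ deg; rewrite -(deg v); apply/subset_leq_card/subsetP => w.
by rewrite !inE => /andP[].
Qed.

(** With colour [c0], [v] agrees with its [D - b] neighbours outside [S]. Over the other colours the
    agreements total at most [b], and [sum_pow_le] bounds the sum of powers by the case where one
    colour takes them all. *)
Lemma support_weight_step (S : {set 'I_n}) (v : 'I_n) (b := #|[set w in S :\ v | A (v, w)]|) :
  v \in S ->
  support_weight S * lam ^ (D - b) <= support_weight (S :\ v) * (lam ^ b + (INR q - 1) - 1).
Proof.
move=> vS; rewrite (support_weightD1 vS) -sumR_mulr.
rewrite /support_weight /colour_weight -sumR_mulr; apply: sumR_le => x /eqP xS.
have xv : x v = c0.
  by apply/eqP; have := setD11 v S; rewrite -xS inE => /negbFE.
have b0 : nbr_col A x v c0 = (D - b)%N.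
  have : (nbr_col A x v c0 + b = D)%N.
    case: Areg => _ _ deg; rewrite -[RHS](deg v) /b /nbr_col -xS.
    rewrite -(cardsID [set w | x w == c0] [set w | A (v, w)]); congr (_ + _)%N;
      by apply: eq_card => w; rewrite !inE // andbC.
  by move <-; rewrite addnK.
have bsum : (\sum_(c | c != c0) nbr_col A x v c <= b)%N.
  rewrite /b -sum1_card (partition_big x (fun c => c != c0)) /=; last first.
    by move=> w; rewrite -xS !inE => /andP[].
  apply: leq_sum => c nc; rewrite sum1dep_card -xS; apply/subset_leq_card/subsetP => w.
  by rewrite !inE => /andP[-> /eqP ->]; rewrite eqxx nc.
rewrite -sumR_mulr.
rewrite (eq_sumR (G := fun c => lam ^ mono_edges A x * lam ^ nbr_col A x v c)); last first.
  move=> c _; rewrite -!pow_add -b0; congr (_ ^ _).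
  have off : agree_off v (recolor x v c) x.
    by apply/agree_offP => w /negPf nw; rewrite ffunE nw.
  have := mono_edges_agree_off Areg off.
  by rewrite xv ffunE eqxx (nbr_col_agree_off Areg c off).
rewrite sumR_mull; apply: Rmult_le_compat_l; first exact/Rlt_le/lam_pow_gt0.
apply: Rle_trans (sum_pow_le lam_ge1 bsum) _.
have -> : INR #|[pred c | c != c0]| = INR q - 1; last by lra.
have e : #|[pred c | c != c0]|.+1 = q.
  rewrite -[RHS](card_ord q) (eq_card (B := predC1 c0)) // cardC1 prednK //.
  by apply/card_gt0P; exists c0.
by have := congr1 INR e; rewrite S_INR => <-; lra.
Qed.

Variable h : R.
Hypothesis h_ge1 : 1 <= h.
Hypothesis q_ge2 : (2 <= q)%N.
Hypothesis h_dom : forall b, (b <= D)%N -> lam ^ b <= (INR q - 1) * h ^ b.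

(** Vertices are removed in any order: by [inner_degD1], the values [b] met on the way add up to
    half of [inner_deg A S]. *)
Lemma support_weight_le (S : {set 'I_n}) :
  support_weight S <= support_weight set0
    * (2 * (INR q - 1) / lam ^ D) ^ #|S| * (h * lam) ^ (inner_deg A S)./2.
Proof.
have Q1 : 1 <= INR q - 1 by have := le_INR 2 q (elimT leP q_ge2); rewrite /=; lra.
have [m] := ubnP #|S|; elim: m S => // m IH S.
have [->|[v vS]] := set_0Vmem S; first by rewrite inner_deg0 cards0 /=; lra.
rewrite (cardsD1 v) vS add1n ltnS => /IH {}IH.
set b := #|[set w in S :\ v | A (v, w)]|.
have bD : (b <= D)%N by apply: card_nbrs_in_le.
rewrite (inner_degD1 Areg vS) -/b halfD odd_double andbF add0n doubleK.
rewrite pow_add -tech_pow_Rmult (Rpow_mult_distr _ _ b).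
have := support_weight_step vS; rewrite -/b.
have lD : lam ^ D = lam ^ b * lam ^ (D - b) by rewrite -pow_add; congr (lam ^ _); exact: esym (subnKC bD).
have l1 := lam_pow_gt0 lam_ge1 (D - b); have l2 := lam_pow_gt0 lam_ge1 b.
set w := support_weight (S :\ v) in IH *.
have w0 : 0 <= w := support_weight_ge0 _.
move=> step; apply: (Rmult_le_reg_r (lam ^ (D - b))) => //; apply: Rle_trans step _.
have hb := h_dom bD; have h1 := pow_R1_Rle h b h_ge1.
have le2 : lam ^ b + (INR q - 1) - 1 <= 2 * (INR q - 1) * h ^ b by nra.
apply: Rle_trans (Rmult_le_compat_l _ _ _ w0 le2) _.
set c := 2 * (INR q - 1) * h ^ b in le2 *.
apply: Rle_trans (Rmult_le_compat_r c _ _ _ IH) _; first by rewrite /c; nra.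
set X := (_ / _) ^ _; set E := (_ * _) ^ _; set W := support_weight set0.
by apply: Req_le; rewrite lD /c; field; lra.
Qed.

Lemma layer_weight_le (k : nat) (Y : R) :
  (forall S : {set 'I_n}, #|S| = k -> (h * lam) ^ (inner_deg A S)./2 <= Y) ->
  colour_weight A lam (fun x => #|others c0 x| == k)
  <= INR 'C(n, k) * ((2 * (INR q - 1) / lam ^ D) ^ k * Y)
     * colour_weight A lam (fun x => (#|others c0 x| <= k)%N).
Proof.
move=> bound.
have Q1 : 1 <= INR q - 1 by have := le_INR 2 q (elimT leP q_ge2); rewrite /=; lra.
have X0 : 0 <= (2 * (INR q - 1) / lam ^ D) ^ k.
  by apply: pow_le; apply: Rmult_le_pos; [lra | apply/Rlt_le/Rinv_0_lt_compat/lam_pow_gt0].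
have -> : colour_weight A lam (fun x => #|others c0 x| == k)
    = sumR (fun S : {set 'I_n} => #|S| == k) support_weight.
  rewrite /colour_weight /sumR (partition_big (others c0) (fun S => #|S| == k)) //=.
  apply: eq_bigr => S /eqP Sk; apply: eq_bigl => x.
  by rewrite andbC; case: eqP => //= ->; rewrite Sk eqxx.
have w0 : support_weight set0 <= colour_weight A lam (fun x => (#|others c0 x| <= k)%N).
  apply: sumR_sub => [x /eqP ->|x _]; first by rewrite cards0.
  exact/Rlt_le/lam_pow_gt0.
(* For [k > n] there is no support and both sides vanish. Otherwise a set of size [k] exists, and
   [bound] applied to it yields [0 <= Y]. *)
have [k_le|lt_k] := leqP k n; last first.
  rewrite /sumR big1 => [|S /eqP Sk]; last first.
    by have := max_card (mem S); rewrite card_ord Sk leqNgt lt_k.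
  by rewrite bin_small //=; lra.
have Y0 : 0 <= Y.
  have : (0 < 'C(n, k))%N by rewrite bin_gt0.
  rewrite -[X in 'C(X, _)]card_ord -card_draws => /card_gt0P[S]; rewrite inE => /eqP Sk.
  by apply: Rle_trans (bound S Sk); apply: pow_le; nra.
apply: (Rle_trans _ (sumR (fun S : {set 'I_n} => #|S| == k)
    (fun _ => support_weight set0 * ((2 * (INR q - 1) / lam ^ D) ^ k * Y)))).
  apply: sumR_le => S /eqP Sk; apply: Rle_trans (support_weight_le S) _.
  rewrite Sk Rmult_assoc; apply: Rmult_le_compat_l; first exact: support_weight_ge0.
  by apply: Rmult_le_compat_l => //; apply: bound.
rewrite sumR_const.
have -> : #|[pred S : {set 'I_n} | #|S| == k]| = 'C(n, k).
  by rewrite -[X in 'C(X, _)]card_ord -card_draws; apply: eq_card => S; rewrite !inE.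
rewrite !Rmult_assoc; apply: Rmult_le_compat_l; first exact: pos_INR.
rewrite Rmult_comm -!Rmult_assoc; apply: Rmult_le_compat_l => //; nra.
Qed.

End SupportWeight.

(** * Estimates for the constant beta *)

Lemma exp_le x y : x <= y -> exp x <= exp y.
Proof. by case=> [/exp_increasing/Rlt_le|->]; [|apply: Rle_refl]. Qed.

Lemma ln_le x y : 0 < x -> x <= y -> ln x <= ln y.
Proof. by move=> x0 [/(ln_increasing _ _ x0)/Rlt_le|->]; [|apply: Rle_refl]. Qed.

Lemma pow_exp x m : exp x ^ m = exp (INR m * x).
Proof.
elim: m => [|m IH]; first by rewrite /= Rmult_0_l exp_0.
by rewrite -tech_pow_Rmult IH -exp_plus S_INR; congr exp; ring.
Qed.

Lemma INR_expn m j : INR (m ^ j)%N = INR m ^ j.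
Proof. by elim: j => [|j IH]; rewrite ?expn0 // expnS mult_INR IH. Qed.

(** A weak Stirling bound, by induction from [(1 + 1/k)^k <= e]. *)
Lemma pow_le_exp_fact (k : nat) : INR k ^ k <= exp (INR k) * INR k`!.
Proof.
elim: k => [|k IH]; first by rewrite /= exp_0; lra.
have [->|k0] := posnP k; first by rewrite /=; have := exp_ineq1_le 1; lra.
have k0' : 0 < INR k by apply: INR_gt0.
have -> : INR k.+1 ^ k.+1 = INR k.+1 * (INR k ^ k * (1 + / INR k) ^ k).
  by rewrite -tech_pow_Rmult -Rpow_mult_distr; congr (_ * _ ^ _); rewrite S_INR; field; lra.
have le1 : (1 + / INR k) ^ k <= exp 1.
  have -> : exp 1 = exp (/ INR k) ^ k.
    by rewrite pow_exp; congr exp; field; lra.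
  apply: pow_incr; have := exp_ineq1_le (/ INR k); have := Rinv_0_lt_compat _ k0'; lra.
rewrite factS mult_INR S_INR exp_plus.
have f0 := pos_INR k`!; have p0 := pow_le _ k (Rlt_le _ _ k0'); have e0 := exp_pos (INR k).
have q0 : 0 <= (1 + / INR k) ^ k by apply: pow_le; have := Rinv_0_lt_compat _ k0'; lra.
have le2 : INR k ^ k * (1 + / INR k) ^ k <= (exp (INR k) * INR k`!) * exp 1.
  by apply: Rmult_le_compat.
nra.
Qed.

Lemma bin_le_pow (n k : nat) : (0 < k)%N ->
  INR 'C(n, k) <= (exp 1 * INR n / INR k) ^ k.
Proof.
move=> k0; have k0' := INR_gt0 k0.
have ff m j : (m ^_ j <= m ^ j)%N.
  elim: j m => // j IH m; rewrite ffactnS expnS leq_mul2l; apply/orP; right.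
  by apply: leq_trans (IH _) _; have [->|j0] := posnP j; rewrite ?expn0 // leq_exp2r // leq_pred.
have : INR 'C(n, k) * INR k`! <= INR n ^ k.
  rewrite -mult_INR; have := le_INR _ _ (elimT leP (ff n k)).
  by rewrite -bin_ffact INR_expn.
have F := pow_le_exp_fact k.
have f0 : 0 < INR k`! by apply/INR_gt0/fact_gt0.
have kk : 0 < INR k ^ k by apply: pow_lt.
move=> B; apply: (Rmult_le_reg_r (INR k ^ k)) => //.
rewrite -Rpow_mult_distr.
have -> : exp 1 * INR n / INR k * INR k = exp 1 * INR n by field; lra.
rewrite Rpow_mult_distr pow_exp Rmult_1_r.
have c0 := pos_INR 'C(n, k); have e0 := exp_pos (INR k).
nra.
Qed.

Section Beta.
Variables (D : nat) (kappa : R).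
Hypothesis kappa_gt1 : 1 < kappa.
Hypothesis kappa_le : kappa <= INR D / 2.
Let beta := beta_const D kappa.
Let L := ln (INR D / (2 * kappa)).

Lemma INR_D_gt0 : 0 < INR D. Proof. lra. Qed.

Lemma L_ge0 : 0 <= L.
Proof.
rewrite -ln_1; apply: ln_le; first lra.
by apply: (Rmult_le_reg_r (2 * kappa)); [lra | field_simplify; lra].
Qed.

Lemma betaE : 2 * beta = exp (- (1 + 2 / (kappa - 1)) - (1 + 1 / (kappa - 1)) * L).
Proof.
rewrite /beta /beta_const /Rpower -/L -Rmult_assoc -Rmult_assoc Rinv_r; last lra.
by rewrite Rmult_1_l -exp_plus; congr exp; ring.
Qed.

Lemma beta_gt0 : 0 < beta.
Proof. by have := betaE; have := exp_pos (- (1 + 2 / (kappa - 1)) - (1 + 1 / (kappa - 1)) * L); lra. Qed.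

(** With [s = 2 / (kappa - 1)] and [L >= 0], [2 * beta <= exp (- s) <= 1 / s]. This serves to bound
    [n / N] in [union_bound_base]. *)
Lemma beta_le_slope : 2 * beta <= (kappa - 1) / 2.
Proof.
have a0 : 0 < kappa - 1 by lra.
have i0 := Rinv_0_lt_compat _ a0.
have -> : (kappa - 1) / 2 = / (2 / (kappa - 1)) by field; lra.
apply: (Rle_trans _ (exp (- (2 / (kappa - 1))))).
  rewrite betaE; apply: exp_le; have := L_ge0; rewrite /Rdiv; nra.
rewrite exp_Ropp; apply: Rinv_le_contravar; first by rewrite /Rdiv; lra.
by have := exp_ineq1_le (2 / (kappa - 1)); lra.
Qed.

Lemma beta_lt : beta <= / 4.
Proof.
have a0 : 0 < kappa - 1 by lra.
have i0 := Rinv_0_lt_compat _ a0.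
have : 2 * beta <= / exp 1.
  by rewrite betaE -exp_Ropp; apply: exp_le; have := L_ge0; rewrite /Rdiv; nra.
have : / exp 1 <= / 2.
  by apply: Rinv_le_contravar; have := exp_ineq1_le 1; lra.
lra.
Qed.

(** The restriction [y <= 3/4 * beta] is a factor 3/8 below the critical value [2 * beta]; this
    estimate measures the margin gained. It follows from [exp (-1/4) >= 3/4], as 27/64 exceeds
    3/8. *)
Lemma ln_3_8_le : ln (3 / 8) <= - (3 / 4).
Proof.
rewrite -[X in _ <= X]ln_exp; apply: ln_le; first lra.
have -> : - (3 / 4) = - (1 / 4) - (1 / 4) - (1 / 4) by field.
have := exp_ineq1_le (- (1 / 4)); have := exp_pos (- (1 / 4)).
rewrite /Rminus !exp_plus; set x := exp _ => x0 x1.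
have : 9 / 16 <= x * x by nra.
nra.
Qed.

(* With [y = k / N], the base is [n / N * exp (1 + kappa) (D / 2 kappa)^kappa y^(kappa - 1)],
   and [2 beta] is the value of [y] for which the factor after [n / N] equals [1]. *)
Lemma union_bound_base (n k : R) (N := n - 2 * k - 2 * INR D) :
  0 < k -> 0 < N -> k / N <= 3 / 4 * beta -> 3 * INR D <= k ->
  exp 1 * INR D * (k / N) / (2 * kappa) <= 1 /\
  exp 1 * n / k * Rpower (exp 1 * INR D * (k / N) / (2 * kappa)) kappa
    <= exp (- (kappa - 1) / 4).
Proof.
move=> k0 N0 yb kD; set y := k / N in yb *.
have D0 := INR_D_gt0; have b0 := beta_gt0.
have y0 : 0 < y by apply: Rdiv_lt_0_compat.
have a0 : 0 < kappa - 1 by lra.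
have DK : 0 < INR D / (2 * kappa) by apply: Rdiv_lt_0_compat; lra.
set c := exp 1 * INR D * y / (2 * kappa).
have cE : c = exp 1 * (INR D / (2 * kappa)) * y by rewrite /c; field; lra.
have e0 := exp_pos 1.
have c0 : 0 < c by rewrite cE; apply: Rmult_lt_0_compat => //; apply: Rmult_lt_0_compat.
have lnc : ln c = 1 + L + ln y.
  by rewrite cE (ln_mult (_ * _)) ?(ln_mult (exp 1)) ?ln_exp //; apply: Rmult_lt_0_compat.
have lny : ln y <= ln (3 / 8) - (1 + 2 / (kappa - 1)) - (1 + 1 / (kappa - 1)) * L.
  apply: (Rle_trans _ (ln (3 / 8 * (2 * beta)))); first by apply: ln_le; lra.
  by rewrite ln_mult; [rewrite betaE ln_exp; lra | lra | lra].
have L0 := L_ge0; have l38 := ln_3_8_le.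
have i0 := Rinv_0_lt_compat _ a0.
have lnc0 : ln c <= 0.
  have : 0 <= 1 / (kappa - 1) * L by apply: Rmult_le_pos; lra.
  by rewrite /Rdiv in lny *; lra.
split.
  by rewrite -(exp_ln _ c0) -exp_0; apply: exp_le.
have n0 : 0 < n by rewrite /N in N0; lra.
(* From [y <= 3/4 * beta] and [k >= 3 * D], the excess [2 * y + 2 * D / N] is at most
   [3/2 * beta + 1/2 * beta = 2 * beta]. *)
have rho : n / N <= exp ((kappa - 1) / 2).
  have -> : n / N = 1 + (2 * y + 2 * INR D / N) by rewrite /y /N; field; rewrite /N in N0; lra.
  apply: Rle_trans (exp_ineq1_le _); apply: Rplus_le_compat_l.
  apply: Rle_trans beta_le_slope.
  have -> : 2 * INR D / N = 2 * (INR D / k) * y by rewrite /y; field; lra.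
  have : INR D / k <= / 3.
    apply: (Rmult_le_reg_r k) => //; rewrite /Rdiv Rmult_assoc Rinv_l; lra.
  nra.
have nk0 : 0 < exp 1 * n / k by apply: Rdiv_lt_0_compat => //; apply: Rmult_lt_0_compat.
rewrite -(exp_ln _ nk0) /Rpower -exp_plus; apply: exp_le.
have -> : exp 1 * n / k = exp 1 * ((n / N) * / y) by rewrite /y; field; lra.
have nN0 : 0 < n / N by apply: Rdiv_lt_0_compat.
have iy0 : 0 < / y by apply: Rinv_0_lt_compat.
rewrite (ln_mult (exp 1)) ?(ln_mult (n / N)) ?ln_exp ?(ln_Rinv y) //; last exact: Rmult_lt_0_compat.
have : ln (n / N) <= (kappa - 1) / 2.
  by rewrite -[X in _ <= X]ln_exp; apply: ln_le.
have : (kappa - 1) * ln y <= (kappa - 1) *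
   (ln (3 / 8) - (1 + 2 / (kappa - 1)) - (1 + 1 / (kappa - 1)) * L).
  by apply: Rmult_le_compat_l => //; lra.
have -> : (kappa - 1) * (ln (3 / 8) - (1 + 2 / (kappa - 1)) - (1 + 1 / (kappa - 1)) * L)
   = (kappa - 1) * ln (3 / 8) - (kappa - 1) - 2 - (kappa - 1) * L - L by field; lra.
(* The terms [1 + kappa + kappa * L] cancel, leaving [(kappa - 1) * (ln (3/8) + 1/2)], at most
   [- (kappa - 1) / 4]. *)
rewrite lnc; nra.
Qed.

(* [Q h^b = Q^(1 - b/D) lam^b] is the log-linear chord on [0 <= b <= D] of the log-convex
   [max (lam^b, Q)]; it is this chord that produces the exponent of [lam] in the hypothesis. *)
Lemma layer_base (lam Q : R) : 1 <= lam -> 1 <= Q ->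
  Q <= beta ^ 2 / (256 * exp 1 ^ 2)
       * Rpower lam (INR D - kappa - kappa ^ 2 / (INR D - kappa)) ->
  let h := lam * Rpower Q (- / INR D) in
  [/\ 1 <= h, forall b, (b <= D)%N -> lam ^ b <= Q * h ^ b
    & 2 * Q / lam ^ D * Rpower (h * lam) kappa <= beta / (8 * exp 1)].
Proof.
move=> lam1 Q1 Qle h; have D0 := INR_D_gt0; have b0 := beta_gt0; have b4 := beta_lt.
have Dk : 0 < INR D - kappa by lra.
have e0 := exp_pos 1; have e2 := exp_ineq1_le 1.
have lnl : 0 <= ln lam by rewrite -ln_1; apply: ln_le; lra.
have lnQ : 0 <= ln Q by rewrite -ln_1; apply: ln_le; lra.
set c := beta / (16 * exp 1).
have c0 : 0 < c by apply: Rdiv_lt_0_compat; lra.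
have lnc : ln c <= 0.
  rewrite -ln_1; apply: ln_le => //.
  by apply: (Rmult_le_reg_r (16 * exp 1)); [lra | rewrite /c; field_simplify; lra].
have lnQle : ln Q <= 2 * ln c + (INR D - kappa - kappa ^ 2 / (INR D - kappa)) * ln lam.
  have -> : 2 * ln c = ln (c * c) by rewrite ln_mult //; lra.
  have cc : c * c = beta ^ 2 / (256 * exp 1 ^ 2) by rewrite /c; field; lra.
  rewrite -cc in Qle.
  rewrite -[X in _ + X]ln_exp -ln_mult; [|nra|exact: exp_pos].
  by apply: ln_le; [lra | exact: Qle].
set E := INR D - kappa - _ in lnQle.
(* This identity is why the exponent contains [kappa ^ 2 / (D - kappa)]: it makes the powers of
   [lam] cancel exactly in the last claim. *)
have ED : E * (INR D - kappa) = INR D * (INR D - 2 * kappa) by rewrite /E; field; lra.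
have hE : h = exp (ln lam - ln Q / INR D).
  rewrite /h /Rpower -{1}(exp_ln lam) -?exp_plus; last lra.
  by congr exp; field; lra.
have E_le : E <= INR D.
  rewrite /E; have : 0 <= kappa ^ 2 / (INR D - kappa); last lra.
  by apply: Rmult_le_pos; [nra | apply/Rlt_le/Rinv_0_lt_compat].
have lnQD : ln Q / INR D <= ln lam.
  apply: (Rmult_le_reg_r (INR D)) => //.
  by rewrite /Rdiv Rmult_assoc Rinv_l; [nra | lra].
split.
- by rewrite hE -exp_0; apply: exp_le; lra.
- move=> b bD; have bD' := le_INR _ _ (elimT leP bD).
  rewrite hE pow_exp -{1}(exp_ln Q); last lra.
  rewrite -{1}(exp_ln lam); last lra.
  rewrite pow_exp -exp_plus; apply: exp_le.
  have : INR b * (ln Q / INR D) <= ln Q; last by have := pos_INR b; lra.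
  apply: (Rmult_le_reg_r (INR D)) => //.
  have -> : INR b * (ln Q / INR D) * INR D = INR b * ln Q by field; lra.
  nra.
- have -> : beta / (8 * exp 1) = 2 * exp (ln c) by rewrite exp_ln // /c; field; lra.
  have -> : 2 * Q / lam ^ D * Rpower (h * lam) kappa =
     2 * exp (ln Q - INR D * ln lam + kappa * (2 * ln lam - ln Q / INR D)).
    have lp : lam ^ D = exp (INR D * ln lam).
      by rewrite -{1}(exp_ln lam) ?pow_exp //; lra.
    have lhl : ln (h * lam) = 2 * ln lam - ln Q / INR D.
      by rewrite hE ln_mult ?ln_exp; [ring | exact: exp_pos | lra].
    rewrite lp /Rpower lhl -{1}(exp_ln Q); last lra.
    rewrite /Rdiv -exp_Ropp !Rmult_assoc; congr (_ * _).
    by rewrite -!exp_plus; congr exp; rewrite /Rdiv; ring.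
  apply: Rmult_le_compat_l; first lra.
  apply: exp_le.
  have -> : ln Q - INR D * ln lam + kappa * (2 * ln lam - ln Q / INR D) =
    (INR D - kappa) / INR D * ln Q - (INR D - 2 * kappa) * ln lam by field; lra.
  (* Since [ln c <= 0] and the coefficient of [ln Q] is at least 1/2, the square [c ^ 2] in the
     bound on [Q] still leaves a full factor [c]. *)
  have r1 : / 2 <= (INR D - kappa) / INR D.
    by apply: (Rmult_le_reg_r (INR D)) => //; rewrite /Rdiv Rmult_assoc Rinv_l; lra.
  set r := (INR D - kappa) / INR D in r1 *.
  have rE : r * E = INR D - 2 * kappa.
    have -> : r * E = (E * (INR D - kappa)) / INR D by rewrite /r; field; lra.
    by rewrite ED; field; lra.
  have : r * ln Q <= r * (2 * ln c + E * ln lam) by apply: Rmult_le_compat_l; lra.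
  nra.
Qed.

End Beta.

(** * Random regular graphs and the mixing time *)

Definition locally_dense_graphs (n D k m : nat) : {set graph n} :=
  [set A | is_simple_regular D A &&
    [exists S : {set 'I_n}, (#|S| == k) && (m.*2 <= inner_deg A S)%N]].

(** Iterating [dense_graphs_step] from [j = 0] multiplies the factors [2 * (j + 1) * M] into
    [m! * (2 * M) ^ m]. The product form stays valid when the truncated subtraction makes [M]
    zero. *)
Lemma card_dense_graphs (n D : nat) (S : {set 'I_n}) (m : nat)
    (M := (D * n - 2 * D * #|S| - 2 * D * D)%N) :
  (#|dense_graphs D S m| * (m`! * (2 * M) ^ m)
   <= #|[pred A : graph n | is_simple_regular D A]| * ((#|S| * D) ^ 2) ^ m)%N.
Proof.
elim: m => [|m IH].
  rewrite !expn0 fact0 !muln1; apply/subset_leq_card/subsetP => A.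
  by rewrite !inE => /andP[].
have step := dense_graphs_step D S m; rewrite -/M -muln2 in step.
rewrite factS [(_ ^ m.+1)%N]expnS [(((_ * _) ^ 2) ^ m.+1)%N]expnS.
move: step IH; set d := #|_|; set d' := #|_|; set r := #|_|; set Y := (_ ^ 2)%N.
set Z := ((2 * M) ^ m)%N; set F := m`! => step IH.
have -> : (d * (m.+1 * F * (2 * M * Z)) = d * (m.+1 * 2 * M) * (F * Z))%N by lia.
apply: leq_trans (leq_mul step (leqnn _)) _.
have -> : (d' * Y * (F * Z) = d' * (F * Z) * Y)%N by lia.
by apply: leq_trans (leq_mul IH (leqnn _)) _; rewrite -mulnA [(Y ^ m * Y)%N]mulnC.
Qed.

Lemma card_bigcup_le (I T : finType) (P : pred I) (F : I -> {set T}) :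
  (#|\bigcup_(i | P i) F i| <= \sum_(i | P i) #|F i|)%N.
Proof.
apply: (big_ind2 (fun (X : {set T}) s => #|X| <= s)%N) => [|X s Y t Xs Yt|//].
  by rewrite cards0.
exact: leq_trans (leq_card_setU X Y) (leq_add Xs Yt).
Qed.

Lemma card_locally_dense (n D k m : nat) (M := (D * n - 2 * D * k - 2 * D * D)%N) :
  (#|locally_dense_graphs n D k m| * (m`! * (2 * M) ^ m)
   <= 'C(n, k) * (#|[pred A : graph n | is_simple_regular D A]| * ((k * D) ^ 2) ^ m))%N.
Proof.
have sub : locally_dense_graphs n D k m \subset
    \bigcup_(S : {set 'I_n} | #|S| == k) dense_graphs D S m.
  apply/subsetP => A; rewrite inE => /andP[reg /existsP[S /andP[Sk le]]].
  by apply/bigcupP; exists S => //; rewrite inE reg.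
have /leq_trans := leq_trans (subset_leq_card sub) (card_bigcup_le _ _).
move=> /(_ _ (leqnn _)) /leq_mul /(_ (leqnn (m`! * (2 * M) ^ m)%N)) /leq_trans; apply.
rewrite big_distrl -[X in 'C(X, _)]card_ord -card_draws.
rewrite -sum_nat_const big_mkcond [X in (_ <= X)%N]big_mkcond /=.
apply: leq_sum => S _; rewrite inE; case: eqP => // Sk.
by have := card_dense_graphs D S m; rewrite Sk.
Qed.

Lemma prob_regular_ge (n D : nat) (P : graph n -> Prop) (B : {set graph n}) (eps : R) :
  (exists A : graph n, is_simple_regular D A) ->
  (forall A, is_simple_regular D A -> A \notin B -> P A) ->
  INR #|B| <= eps * INR #|[pred A : graph n | is_simple_regular D A]| ->
  1 - eps <= prob_regular D P.
Proof.
move=> [A0 A0reg] good small; rewrite /prob_regular.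
set N := INR #|[pred A : graph n | is_simple_regular D A]| in small *.
have N0 : 0 < N by apply/INR_gt0/card_gt0P; exists A0.
apply: (Rmult_le_reg_r N) => //; rewrite /Rdiv Rmult_assoc Rinv_l; last lra.
rewrite Rmult_1_r; apply: (Rle_trans _ (N - INR #|B|)); first lra.
have -> : N = sumR (fun A : graph n => is_simple_regular D A) (fun _ => 1).
  by rewrite sumR_const Rmult_1_r.
have ind_ge0 A : 0 <= if A \in B then 1 else 0 by case: ifP => _; lra.
have BE : sumR predT (fun A => if A \in B then 1 else 0) = INR #|B|.
  have := sumR_const (mem B) 1; rewrite Rmult_1_r => <-.
  by rewrite /sumR [RHS]big_mkcond.
have le := @sumR_sub _ predT (fun A : graph n => is_simple_regular D A) _
  (fun _ _ => isT) (fun A _ => ind_ge0 A).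
have : sumR (fun A : graph n => is_simple_regular D A) (fun _ => 1)
  <= sumR (fun A : graph n => is_simple_regular D A)
      (fun A => indicator (P A) + if A \in B then 1 else 0).
  apply: sumR_le => A reg; rewrite /indicator.
  case: (excluded_middle_informative (P A)) => [pA|nP]; rewrite /=; first by case: ifP => _; lra.
  case: ifP => [_|/negbT nB]; first lra.
  by case: nP; apply: good.
have conclude (x y z b : R) : x <= y + z -> z <= b -> x - b <= y by lra.
rewrite sumRD => total.
exact: conclude total (Rle_trans _ _ _ le (Req_le _ _ BE)).
Qed.

(** With [m! >= (m / e)^m] the count gives the ratio ['C(n, k) * c ^ m]. As [c <= 1] and
    [m >= kappa * k], [c ^ m] is at most [c] to the power [kappa * k], and [union_bound_base] bounds
    the resulting base. *)
Lemma locally_dense_rare (n D k m : nat) (kappa : R)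
    (N := INR n - 2 * INR k - 2 * INR D) :
  1 < kappa -> kappa <= INR D / 2 -> (0 < k)%N -> 0 < N ->
  INR k / N <= 3 / 4 * beta_const D kappa -> 3 * INR D <= INR k ->
  kappa * INR k <= INR m ->
  INR #|locally_dense_graphs n D k m| <= exp (- (kappa - 1) / 4) ^ k
    * INR #|[pred A : graph n | is_simple_regular D A]|.
Proof.
move=> k1 kD k0 N0 yb Dk mk; have k0' := INR_gt0 k0.
have D0 : 0 < INR D by lra.
have [c1 base] := union_bound_base k1 kD k0' N0 yb Dk.
rewrite -/N in c1 base.
set c := exp 1 * INR D * (INR k / N) / (2 * kappa) in c1 base.
have c0 : 0 < c.
  apply: Rdiv_lt_0_compat; last lra.
  apply: Rmult_lt_0_compat; last exact: Rdiv_lt_0_compat.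
  by apply: Rmult_lt_0_compat => //; apply: exp_pos.
have m0 : 0 < INR m by nra.
(* Positivity of [N] makes the truncated subtractions exact. *)
have ME : INR (D * n - 2 * D * k - 2 * D * D)%N = INR D * N.
  have le : (2 * k + 2 * D <= n)%N.
    apply/leP/INR_le; rewrite plus_INR !mult_INR /=; rewrite /N in N0; lra.
  have -> : (D * n - 2 * D * k - 2 * D * D = D * (n - (2 * k + 2 * D)))%N.
    by rewrite mulnBr mulnDr subnDA; congr (_ - _ - _)%N; lia.
  rewrite mult_INR minus_INR; last exact/leP.
  by rewrite plus_INR !mult_INR /N /=; ring.
have := le_INR _ _ (elimT leP (card_locally_dense n D k m)).
rewrite !mult_INR !INR_expn !mult_INR ME.
set a := INR #|_|; set r := INR #|_|; set f := INR m`! => card_le.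
have r0 : 0 <= r := pos_INR _; have a0 : 0 <= a := pos_INR _.
have f0 : 0 < f by apply/INR_gt0/fact_gt0.
have W0 : 0 < 2 * (INR D * N) by nra.
have Wm : 0 < (2 * (INR D * N)) ^ m by apply: pow_lt.
set W := 2 * (INR D * N) in card_le W0 Wm.
have B0 : 0 < exp 1 * INR n / INR k.
  apply: Rdiv_lt_0_compat => //; apply: Rmult_lt_0_compat; first exact: exp_pos.
  by rewrite /N in N0; lra.
have key : ((INR k * INR D) ^ 2) ^ m <= c ^ m * (f * W ^ m).
  apply: (Rle_trans _ ((c * W * (INR m / exp 1)) ^ m)).
    apply: pow_incr; split; first exact: pow2_ge_0.
    have -> : c * W * (INR m / exp 1) = INR D ^ 2 * INR k * (INR m / kappa).
      by rewrite /c /W; field; have := exp_pos 1; split; [lra | split; lra].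
    have -> : (INR k * INR D) ^ 2 = INR D ^ 2 * INR k * INR k by ring.
    apply: Rmult_le_compat_l; first by nra.
    by apply: (Rmult_le_reg_r kappa); [lra | field_simplify; lra].
  rewrite (Rpow_mult_distr (c * W)) (Rpow_mult_distr c W) (Rpow_mult_distr (INR m)).
  have F := pow_le_exp_fact m; have e0 := exp_pos (INR m).
  have -> : (/ exp 1) ^ m = / exp (INR m).
    by rewrite -exp_Ropp pow_exp -exp_Ropp; congr exp; ring.
  have : INR m ^ m * / exp (INR m) <= f.
    apply: (Rmult_le_reg_r (exp (INR m))) => //.
    by rewrite Rmult_assoc Rinv_l; [rewrite /f; lra | lra].
  have cm := pow_lt _ m c0.
  move=> le; rewrite Rmult_assoc; apply: Rmult_le_compat_l; first lra.
  by rewrite (Rmult_comm f); apply: Rmult_le_compat_l; lra.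
have cm_le : c ^ m <= Rpower c kappa ^ k.
  rewrite -(Rpower_pow m c c0) -Rpower_pow; last exact: exp_pos.
  rewrite Rpower_mult /Rpower; apply: exp_le.
  have : ln c <= 0 by rewrite -ln_1; apply: ln_le.
  nra.
have total : INR 'C(n, k) * c ^ m <= exp (- (kappa - 1) / 4) ^ k.
  apply: (Rle_trans _ ((exp 1 * INR n / INR k) ^ k * Rpower c kappa ^ k)).
    apply: Rmult_le_compat; [exact: pos_INR | exact/Rlt_le/pow_lt | exact: bin_le_pow | done].
  rewrite -Rpow_mult_distr; apply: pow_incr; split=> //.
  by apply: Rmult_le_pos; [lra | exact/Rlt_le/exp_pos].
have fW : 0 < f * W ^ m by apply: Rmult_lt_0_compat.
apply: (Rmult_le_reg_r (f * W ^ m)) => //; apply: Rle_trans card_le _.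
apply: (Rle_trans _ (INR 'C(n, k) * (r * (c ^ m * (f * W ^ m))))).
  by do 2 (apply: Rmult_le_compat_l; [exact: pos_INR |]).
have -> : INR 'C(n, k) * (r * (c ^ m * (f * W ^ m))) =
  (INR 'C(n, k) * c ^ m) * (r * (f * W ^ m)) by ring.
rewrite [X in _ <= X]Rmult_assoc; apply: Rmult_le_compat_r => //.
by apply: Rmult_le_pos; lra.
Qed.

Lemma nat_above (x : R) : 0 <= x -> exists2 m : nat, x < INR m & INR m <= x + 1.
Proof.
move=> x0; have [up1 up2] := archimed x; exists (Z.to_nat (up x)).
  by rewrite INR_IZR_INZ Z2Nat.id //; apply: le_IZR; lra.
by rewrite INR_IZR_INZ Z2Nat.id; [lra | apply: le_IZR; lra].
Qed.

Lemma slow_mixing (n D q k m : nat) (A : graph n) (lam kappa : R)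
    (beta := beta_const D kappa) :
  1 < kappa -> kappa <= INR D / 2 -> 1 <= lam -> (2 <= q)%N ->
  INR q - 1 <= beta ^ 2 / (256 * exp 1 ^ 2)
    * Rpower lam (INR D - kappa - kappa ^ 2 / (INR D - kappa)) ->
  is_simple_regular D A -> A \notin locally_dense_graphs n D k m ->
  (0 < k)%N -> (2 * k < n)%N -> INR m <= kappa * INR k + 1 ->
  beta * INR n / 2 <= INR k -> 4 <= beta * INR n ->
  mixing_time_ge q A lam (Rpower 2 (beta * INR n - 4)).
Proof.
move=> k1 kD lam1 q2 Qle reg sparse k0 kn mk bk bn.
have Q1 : 1 <= INR q - 1 by have := le_INR 2 q (elimT leP q2); rewrite /=; lra.
have [h1 hdom base] := layer_base k1 kD lam1 Q1 Qle.
set h := lam * _ in h1 hdom base.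
have k0' := INR_gt0 k0; have e0 := exp_pos 1.
have Areg : regular D A by apply/regularP.
pose c0 : 'I_q := Ordinal (ltnW q2); pose c1 : 'I_q := Ordinal q2.
(* Sparsity is strict, so the number of inner edges is at most [m - 1], hence at most [kappa * k]
   although [m] is rounded up. *)
have sparse' (S : {set 'I_n}) : #|S| = k ->
    (h * lam) ^ (inner_deg A S)./2 <= Rpower (h * lam) kappa ^ k.
  move=> Sk; have hl : 1 <= h * lam by nra.
  have : (inner_deg A S < m.*2)%N.
    move: sparse; rewrite inE reg /= negb_exists => /forallP/(_ S).
    by rewrite Sk eqxx /= -ltnNge.
  move=> lt_m; have : ((inner_deg A S)./2.+1 <= m)%N by lia.
  move=> /leP/le_INR; rewrite S_INR => em.
  rewrite -Rpower_pow; last lra.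
  rewrite -Rpower_pow; last exact: exp_pos.
  rewrite Rpower_mult; apply: Rle_Rpower => //; lra.
apply: (@mixing_time_geI n D q A lam Areg lam1 _ c0 c1 k) => //.
- by apply: leq_trans kn.
- exact/Rlt_le/exp_pos.
have layer := layer_weight_le c0 Areg lam1 h1 q2 hdom sparse'.
set w := colour_weight _ _ _ in layer *; set W := colour_weight _ _ _ in layer *.
have W0 : 0 <= W by apply: sumR_ge0 => x _; exact/Rlt_le/lam_pow_gt0.
rewrite -Rpow_mult_distr in layer.
set X := _ * Rpower (h * lam) kappa in base layer.
have X0 : 0 <= X.
  apply: Rmult_le_pos; last exact/Rlt_le/exp_pos.
  apply: Rmult_le_pos; first lra.
  exact/Rlt_le/Rinv_0_lt_compat/lam_pow_gt0.
(* The base is at most [(e * n / k) * beta / (8 * e) = beta * n / (8 * k)], which is at most 1/4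
   because [k >= beta * n / 2]. *)
have CX : INR 'C(n, k) * X ^ k <= / 4 ^ k.
  apply: (Rle_trans _ ((exp 1 * INR n / INR k) ^ k * X ^ k)).
    by apply: Rmult_le_compat_r; [exact: pow_le | exact: bin_le_pow].
  rewrite -Rpow_mult_distr -pow_inv; apply: pow_incr.
  have en : 0 <= exp 1 * INR n / INR k.
    apply: Rmult_le_pos; last exact/Rlt_le/Rinv_0_lt_compat.
    by apply: Rmult_le_pos; [lra | exact: pos_INR].
  split; first exact: Rmult_le_pos.
  apply: Rle_trans (Rmult_le_compat_l _ _ _ en base) _.
  apply: (Rmult_le_reg_r (INR k)) => //.
  have -> : exp 1 * INR n / INR k * (beta / (8 * exp 1)) * INR k = beta * INR n / 8.
    by field; lra.
  lra.
have T1 : 1 <= Rpower 2 (beta * INR n - 4).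
  rewrite -[X in X <= _](Rpower_O 2); last lra.
  by apply: Rle_Rpower; lra.
set T := Rpower _ _ in T1 *.
(* The 4 in the exponent of [T] splits as one factor 2 for [T + 1 <= 2 * T] and three for the 1/8
   required by [mixing_time_geI]. *)
have TX : 2 * T * / 4 ^ k <= / 8.
  have -> : 2 * T * / 4 ^ k = Rpower 2 (beta * INR n - 3 - 2 * INR k).
    have -> : beta * INR n - 3 - 2 * INR k = 1 + (beta * INR n - 4) + - (2 * INR k) by ring.
    rewrite (Rpower_plus (1 + _)) (Rpower_plus 1) Rpower_1; last lra.
    rewrite Rpower_Ropp -/T; congr (_ * _ * / _).
    have -> : 4 = Rpower 2 2 by rewrite (Rpower_pow 2 2) /=; lra.
    by rewrite -Rpower_pow ?Rpower_mult //; exact: exp_pos.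
  have -> : / 8 = Rpower 2 (- INR 3).
    by rewrite Rpower_Ropp Rpower_pow /=; [congr (/ _); ring | lra].
  by apply: Rle_Rpower; rewrite /=; lra.
apply: Rle_trans (Rmult_le_compat_l (T + 1) _ _ _ layer) _; first lra.
rewrite -Rmult_assoc; apply: Rmult_le_compat_r => //.
apply: Rle_trans TX; apply: Rmult_le_compat; try lra.
by apply: Rmult_le_pos; [exact: pos_INR | exact: pow_le].
Qed.

Theorem theorem4p4 (D : nat) (lam kappa : R) (q : nat) :
  (3 <= D)%N -> (1 <= lam)%R -> (1 < kappa)%R -> (kappa <= INR D / 2)%R ->
  (2 <= q)%N ->
  (INR q - 1 <= (beta_const D kappa) ^ 2 / (256 * (exp 1) ^ 2)
                 * Rpower lam (INR D - kappa - kappa ^ 2 / (INR D - kappa)))%R ->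
  aas D (fun n (A : graph n) =>
           mixing_time_ge q A lam (Rpower 2 (beta_const D kappa * INR n - 4))).
Proof.
move=> D3 lam1 k1 kD q2 Qle eps eps0.
have b0 := beta_gt0 D kappa; have b4 := beta_lt k1 kD.
set beta := beta_const D kappa in Qle b0 b4 *.
have D3' := le_INR 3 D (elimT leP D3); rewrite /= in D3'.
have l0 := Rabs_pos (ln eps).
(* The first term serves [Nk]: with [beta <= 1/4] and [k <= beta * n / 2 + 1], it suffices that
   [11/12 * beta * n + 11/6 + D / 2 <= beta * n]. The second makes [exp (- (kappa - 1) * k / 4)] at
   most [eps]. *)
pose X := (22 + 6 * INR D) / beta + 8 * Rabs (ln eps) / ((kappa - 1) * beta).
have t1 : 0 <= (22 + 6 * INR D) / beta by apply/Rlt_le/Rdiv_lt_0_compat; lra.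
have kb : 0 < (kappa - 1) * beta by nra.
have t2 : 0 <= 8 * Rabs (ln eps) / ((kappa - 1) * beta).
  by apply: Rmult_le_pos; [lra | exact/Rlt_le/Rinv_0_lt_compat].
have [N XN _] := nat_above (Rplus_le_le_0_compat _ _ t1 t2).
exists N => n Nn par; have Nn' := le_INR _ _ (elimT leP Nn).
have n1 : 22 + 6 * INR D <= beta * INR n.
  have -> : 22 + 6 * INR D = beta * ((22 + 6 * INR D) / beta) by field; lra.
  by apply: Rmult_le_compat_l; lra.
have n2 : 8 * Rabs (ln eps) <= (kappa - 1) * beta * INR n.
  have -> : 8 * Rabs (ln eps)
    = (kappa - 1) * beta * (8 * Rabs (ln eps) / ((kappa - 1) * beta)) by field; lra.
  by apply: Rmult_le_compat_l; lra.
have n0 : 0 <= INR n := pos_INR n.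
have [k bk kb1] := nat_above (ltac:(nra) : 0 <= beta * INR n / 2).
have k0 : (0 < k)%N by apply/ltP/INR_lt; rewrite /=; lra.
have Nk : 4 / 3 * INR k <= beta * (INR n - 2 * INR k - 2 * INR D) by nra.
have N0 : 0 < INR n - 2 * INR k - 2 * INR D by nra.
have yb : INR k / (INR n - 2 * INR k - 2 * INR D) <= 3 / 4 * beta.
  apply: (Rmult_le_reg_r (INR n - 2 * INR k - 2 * INR D)) => //.
  by rewrite /Rdiv Rmult_assoc Rinv_l; lra.
have kn : (2 * k < n)%N.
  by apply/ltP/INR_lt; rewrite mult_INR /=; lra.
have Dn : (D < n)%N by apply/ltP/INR_lt; nra.
have [m mk mk1] := nat_above (ltac:(nra) : 0 <= kappa * INR k).
apply: (@prob_regular_ge n D _ (locally_dense_graphs n D k m)).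
- exact: regular_graph_exists.
- move=> A reg sparse.
  by apply: (slow_mixing k1 kD lam1 q2 Qle reg sparse) => //; rewrite -?/beta; lra.
apply: Rle_trans (locally_dense_rare k1 kD k0 N0 yb _ _) _; [lra | lra |].
apply: Rmult_le_compat_r; first exact: pos_INR.
rewrite pow_exp -[X in _ <= X](exp_ln _ eps0); apply: exp_le.
have := Rle_abs (- ln eps); rewrite Rabs_Ropp.
nra.
Qed.
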